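(* Let $n\ge2$ and let $\gamma$ be a smooth closed curve in $\mathbb{R}^n$, parameterized by arc length, satisfying: (1) any line in $\mathbb{R}^n$ intersects $\gamma$ in at most two points, and if it intersects $\gamma$ at two points, the intersections are with non-zero angles; (2) the curvature of $\gamma$ does not vanish; (3) for every two distinct points $\gamma(x)\ne\gamma(y)$ of the curve, the $2$-planes $\pi_{xy}$ and $\pi_{yx}$ are not orthogonal, where $\pi_{xy}$ is the $2$-plane spanned by the tangent vector $\gamma'(x)$ and the chord $\gamma(y)-\gamma(x)$. For integers $1\le p<q$ let $R_{p,q}$ be the greatest perimeter of a $q$-gon with rotation number $p$ inscribed in $\gamma$. Then for all relatively prime positive integers $p,q$ with $p<q-1$, $$R_{p,q-1}+R_{p,q+1}<2R_{p,q}.$$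
   Context: Let $L$ be the length of $\gamma$, viewed as an $L$-periodic map $\gamma:\mathbb{R}\to\mathbb{R}^n$. An inscribed $q$-gon with rotation number $p$ is given by real numbers $x_0\le x_1\le\dots\le x_q=x_0+pL$ with $0\le x_{i+1}-x_i\le L$; its vertices $\gamma(x_0),\dots,\gamma(x_{q-1})$, in this cyclic order, lie on $\gamma$, and its perimeter is $\sum_{i=0}^{q-1}|\gamma(x_{i+1})-\gamma(x_i)|$. The planes $\pi_{xy}$ and $\pi_{yx}$ both contain the direction of the chord $\gamma(y)-\gamma(x)$; they are orthogonal if the components of $\gamma'(x)$ and $\gamma'(y)$ perpendicular to this chord are orthogonal to each other. The integers $p,q$ in the definition of $R_{p,q}$ need not be relatively prime. *)

(* Defs.v *)
From HB Require Import structures.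
From mathcomp Require Import all_boot all_order all_algebra.
From mathcomp Require Import all_classical all_reals all_analysis.
Set Implicit Arguments.
Unset Strict Implicit.
Unset Printing Implicit Defensive.
Import Order.TTheory GRing.Theory Num.Theory.
Import numFieldNormedType.Exports.
Local Open Scope classical_set_scope.
Local Open Scope ring_scope.

(* The library norm `|u| on 'rV[R]_n is the sup norm; it is equivalent to the
   Euclidean norm enorm, so it gives the usual derivatives, but lengths and
   angles below have to be measured with dot and enorm. *)
Definition dot (R : realType) (n : nat) (u v : 'rV[R]_n) : R :=
  \sum_(i < n) u 0 i * v 0 i.

Definition enorm (R : realType) (n : nat) (u : 'rV[R]_n) : R :=
  Num.sqrt (dot u u).

Definition smooth (R : realType) (n : nat) (g : R -> 'rV[R]_n) : Prop :=
  forall (k : nat) (t : R), derivable (derive1n k g) t 1.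

(* A smooth closed curve of length L parameterized by arc length.  L is the
   least period: g runs through the curve once over [0, L].  Without this, a
   circle traversed twice would satisfy all the hypotheses on the curve made
   below, when its intersections with lines are counted as points of R^n.
   Embeddedness is not required here. *)
Record arclength_closed_curve (R : realType) (n : nat)
    (g : R -> 'rV[R]_n) (L : R) : Prop := ArclengthClosedCurve {
  curve_smooth : smooth g ;
  curve_unit_speed : forall t : R, enorm (derive1 g t) = 1 ;
  curve_length_gt0 : 0 < L ;
  curve_periodic : periodic g L ;
  curve_least_period : forall T : R, 0 < T < L -> ~ periodic g T }.

(* Curvature with respect to an arc length parameter. *)
Definition curvature (R : realType) (n : nat) (g : R -> 'rV[R]_n) (t : R) : R :=
  enorm (derive1n 2 g t).

Definition line (R : realType) (n : nat) (a v : 'rV[R]_n) : set 'rV[R]_n :=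
  [set a + s *: v | s in [set: R]].

(* Unoriented angle, in [0, pi/2], between the lines directed by the nonzero
   vectors u and v. *)
Definition line_angle (R : realType) (n : nat) (u v : 'rV[R]_n) : R :=
  acos (`|dot u v| / (enorm u * enorm v)).

Definition meets_lines_nicely (R : realType) (n : nat)
    (g : R -> 'rV[R]_n) : Prop :=
  forall a v : 'rV[R]_n, v != 0 ->
    ((line a v `&` range g)%classic #<= `I_2)%card /\
    (forall x y : R, line a v (g x) -> line a v (g y) -> g x <> g y ->
       line_angle v (derive1 g x) <> 0 /\ line_angle v (derive1 g y) <> 0).

(* Component of u perpendicular to the nonzero vector c. *)
Definition perp_component (R : realType) (n : nat) (c u : 'rV[R]_n) :
    'rV[R]_n :=
  u - (dot u c / dot c c) *: c.

(* Orthogonality of the planes pi_xy and pi_yx, for g x <> g y. *)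
Definition orthogonal_planes (R : realType) (n : nat) (g : R -> 'rV[R]_n)
    (x y : R) : Prop :=
  let c := g y - g x in
  dot (perp_component c (derive1 g x)) (perp_component c (derive1 g y)) = 0.

(* Only the values x 0, ..., x q matter. *)
Definition inscribed_polygon (R : realType) (L : R) (p q : nat)
    (x : nat -> R) : Prop :=
  (forall i, (i < q)%N -> 0 <= x i.+1 - x i <= L) /\ x q = x 0%N + p%:R * L.

Definition perimeter (R : realType) (n : nat) (g : R -> 'rV[R]_n) (q : nat)
    (x : nat -> R) : R :=
  \sum_(i < q) enorm (g (x i.+1) - g (x i)).

(* R_{p,q}.  For 0 < p < q and g continuous and L-periodic, the set is nonempty
   and, by compactness, its supremum is attained: it is the greatest
   perimeter. *)
Definition greatest_perimeter (R : realType) (n : nat) (g : R -> 'rV[R]_n)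
    (L : R) (p q : nat) : R :=
  sup [set perimeter g q x | x in [set x | inscribed_polygon L p q x]].

(* Main.v *)
Require Import Defs.
From HB Require Import structures.
From mathcomp Require Import all_boot all_order all_algebra.
From mathcomp Require Import all_classical all_reals all_analysis.
From mathcomp Require Import ring lra.
Import Order.TTheory GRing.Theory Num.Theory.
Import numFieldNormedType.Exports.
Local Open Scope classical_set_scope.
Local Open Scope ring_scope.

(* The mixed derivative of the chord length H(x, y) = |g y - g x| is
   - D / H^3, where D vanishes for g x <> g y only if the planes are
   orthogonal. Integrated over a rectangle, a positive D would reverse the
   triangle inequality near the diagonal, so D < 0 there. At a double point the
   triangle inequality forces both signs of D nearby, so double points are not
   isolated, hence tangential, hence whole arcs overlap, and g would have a
   smaller period or turn back. So D < 0 for 0 < y - x < L, which gives the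
   strict quadrangle inequality
   H(a, d) + H(b, c) < H(a, c) + H(b, d) for a < b <= c < d <= a + L.

   A longest (p, q-1)-gon and a longest (p, q+1)-gon have nested sides;
   exchanging them gives a longer (2p, 2q)-gon, while R_{2p,2q} <= 2 R_{p,q} by
   exchanging a (2p, 2q)-gon with its own shift. If the nested sides share a
   vertex, the law of reflection there gives strictness. *)

(** * Euclidean inner product and norm on row vectors *)

Section InnerProduct.
Context {R : realType} {n : nat}.
Implicit Types u v w : 'rV[R]_n.

Lemma dotC u v : dot u v = dot v u.
Proof. by apply: eq_bigr => i _; rewrite mulrC. Qed.

Lemma dotDl u v w : dot (u + v) w = dot u w + dot v w.
Proof. by rewrite /dot -big_split; apply: eq_bigr => i _; rewrite mxE mulrDl. Qed.

Lemma dotZl a u v : dot (a *: u) v = a * dot u v.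
Proof. by rewrite /dot mulr_sumr; apply: eq_bigr => i _; rewrite mxE mulrA. Qed.

Lemma dotNl u v : dot (- u) v = - dot u v.
Proof. by rewrite -scaleN1r dotZl mulN1r. Qed.

Lemma dotBl u v w : dot (u - v) w = dot u w - dot v w.
Proof. by rewrite dotDl dotNl. Qed.

Lemma dotDr u v w : dot w (u + v) = dot w u + dot w v.
Proof. by rewrite !(dotC w) dotDl. Qed.

Lemma dotZr a u v : dot u (a *: v) = a * dot u v.
Proof. by rewrite !(dotC u) dotZl. Qed.

Lemma dotNr u v : dot u (- v) = - dot u v.
Proof. by rewrite !(dotC u) dotNl. Qed.

Lemma dotBr u v w : dot w (u - v) = dot w u - dot w v.
Proof. by rewrite dotDr dotNr. Qed.

Lemma dot0l u : dot 0 u = 0.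
Proof. by rewrite -(scale0r 0) dotZl mul0r. Qed.

Lemma dot_ge0 u : 0 <= dot u u.
Proof. by apply: sumr_ge0 => i _; rewrite -expr2 sqr_ge0. Qed.

Lemma dot_eq0 u : dot u u = 0 -> u = 0.
Proof.
move=> /eqP; rewrite psumr_eq0 => [|i _]; last by rewrite -expr2 sqr_ge0.
move=> /allP u0; apply/rowP => i; rewrite mxE.
by have /implyP/(_ isT) := u0 i (mem_index_enum i); rewrite mulf_eq0 orbb => /eqP.
Qed.

Lemma dot_gt0 u : u != 0 -> 0 < dot u u.
Proof. by move=> u0; rewrite lt_def dot_ge0 andbT; apply: contra u0 => /eqP/dot_eq0/eqP. Qed.

Lemma enorm_ge0 u : 0 <= enorm u.
Proof. exact: sqrtr_ge0. Qed.

Lemma enorm_sqr u : enorm u ^+ 2 = dot u u.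
Proof. by rewrite sqr_sqrtr// dot_ge0. Qed.

Lemma enorm_gt0 u : u != 0 -> 0 < enorm u.
Proof. by move=> u0; rewrite sqrtr_gt0 dot_gt0. Qed.

Lemma enorm0 : enorm (0 : 'rV[R]_n) = 0.
Proof. by rewrite /enorm dot0l sqrtr0. Qed.

Lemma enormN u : enorm (- u) = enorm u.
Proof. by rewrite /enorm dotNl dotNr opprK. Qed.

Lemma CauchySchwarz_dot u v : dot u v ^+ 2 <= dot u u * dot v v.
Proof.
have [->|v0] := eqVneq v 0; first by rewrite dotC !dot0l mulr0 expr0n.
have := dot_ge0 (dot v v *: u - dot u v *: v).
rewrite !(dotBl, dotBr, dotZl, dotZr) (dotC v u) => h.
rewrite -subr_ge0 -(pmulr_rge0 _ (dot_gt0 _ v0)); apply: le_trans h _.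
by rewrite le_eqVlt; apply/orP; left; apply/eqP; ring.
Qed.

Lemma dot_le_enorm u v : dot u v <= enorm u * enorm v.
Proof.
apply: le_trans (ler_norm _) _.
rewrite -(@ler_pXn2r _ 2) ?nnegrE ?mulr_ge0 ?enorm_ge0//.
by rewrite exprMn !enorm_sqr real_normK ?num_real// CauchySchwarz_dot.
Qed.

Lemma enormD u v : enorm (u + v) <= enorm u + enorm v.
Proof.
rewrite -(@ler_pXn2r _ 2) ?nnegrE ?addr_ge0 ?enorm_ge0//.
rewrite enorm_sqr sqrrD !enorm_sqr !(dotDl, dotDr) (dotC v u).
by have := dot_le_enorm u v; lra.
Qed.

End InnerProduct.

(** * Derivatives and limits of inner products *)

Section DotCalculus.
Context {R : realType} {n : nat}.

Lemma is_derive_coord (u : R -> 'rV[R]_n) (x : R) du i :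
  is_derive x 1 u du -> is_derive x 1 (fun t => u t 0 i) (du 0 i).
Proof.
move=> [u' <-]; apply: DeriveDef; first by move: i; apply/(derivable_mxP u x 1).1.
by rewrite (derive_mx u') mxE.
Qed.

Lemma is_derive_dot {u v : R -> 'rV[R]_n} {x : R} {du dv} :
  is_derive x 1 u du -> is_derive x 1 v dv ->
  is_derive x 1 (fun t => dot (u t) (v t)) (dot du (v x) + dot (u x) dv).
Proof.
move=> u' v'.
have -> : (fun t => dot (u t) (v t)) = \sum_(i < n) ((fun t => u t 0 i) * (fun t => v t 0 i)).
  by apply/funext => t; rewrite fct_sumE.
have H i := is_deriveM (is_derive_coord _ _ _ i u') (is_derive_coord _ _ _ i v').
apply: is_derive_eq (is_derive_sum H) _.
rewrite big_split /= addrC; congr (_ + _); apply: eq_bigr => i _ //.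
by rewrite [LHS]mulrC.
Qed.

Lemma cvg_dot {T} {F : set_system T} {FF : Filter F} (u v : T -> 'rV[R]_n) a b :
  u x @[x --> F] --> a -> v x @[x --> F] --> b ->
  dot (u x) (v x) @[x --> F] --> dot a b.
Proof.
move=> ua vb; rewrite /dot; apply: cvg_big => [|i _]; first exact: add_continuous.
apply: cvgM.
- exact: (cvg_comp u _ ua (@coord_continuous _ 1 n 0 i a)).
- exact: (cvg_comp v _ vb (@coord_continuous _ 1 n 0 i b)).
Qed.

End DotCalculus.

(** * Mixed differences of the chord length *)

Section MixedDifference.
Context {R : realType} {n : nat}.
Variables g g1 : R -> 'rV[R]_n.
Hypothesis g_der : forall t : R, is_derive t 1 g (g1 t).
Hypothesis g1_continuous : continuous g1.

Definition chord_length (x y : R) : R := enorm (g y - g x).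

(* [- chord_length ^ 3] times the mixed second derivative of [chord_length];
   for [g x <> g y] it vanishes exactly when the planes are orthogonal. *)
Definition twist (x y : R) : R :=
  dot (g1 x) (g1 y) * dot (g y - g x) (g y - g x)
  - dot (g1 x) (g y - g x) * dot (g1 y) (g y - g x).

Lemma curve_continuous : continuous g.
Proof. by move=> t; apply/differentiable_continuous/derivable1_diffP; case: (g_der t). Qed.

Lemma chord_length_ge0 x y : 0 <= chord_length x y.
Proof. exact: enorm_ge0. Qed.

Lemma chord_lengthC x y : chord_length x y = chord_length y x.
Proof. by rewrite /chord_length -enormN opprB. Qed.

Lemma chord_lengthxx x : chord_length x x = 0.
Proof. by rewrite /chord_length subrr enorm0. Qed.

Lemma chord_length_gt0 x y : g x <> g y -> 0 < chord_length x y.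
Proof. by move=> /eqP gxy; rewrite enorm_gt0// subr_eq0 eq_sym. Qed.

Lemma chord_length_triangle x y z :
  chord_length x z <= chord_length x y + chord_length y z.
Proof.
rewrite /chord_length (le_trans _ (enormD _ _))//.
by rewrite [_ + (_ - _)]addrC subrKA.
Qed.

Lemma twistC x y : twist x y = twist y x.
Proof.
rewrite /twist -(opprB (g x) (g y)) !(dotNl, dotNr) !opprK (dotC (g1 y) (g1 x)).
by ring.
Qed.

Lemma continuous_dot (u v : R -> 'rV[R]_n) (x : R) :
  {for x, continuous u} -> {for x, continuous v} ->
  {for x, continuous (fun t => dot (u t) (v t))}.
Proof. by move=> cu cv; exact: cvg_dot. Qed.

Lemma continuous_twist (u v : R -> R) (x : R) :
  {for x, continuous u} -> {for x, continuous v} ->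
  {for x, continuous (fun t => twist (u t) (v t))}.
Proof.
move=> cu cv.
have gu : {for x, continuous (fun t => g (u t))}.
  by apply: continuous_comp; [|exact: curve_continuous].
have gv : {for x, continuous (fun t => g (v t))}.
  by apply: continuous_comp; [|exact: curve_continuous].
have g1u : {for x, continuous (fun t => g1 (u t))} by apply: continuous_comp; [|exact: g1_continuous].
have g1v : {for x, continuous (fun t => g1 (v t))} by apply: continuous_comp; [|exact: g1_continuous].
have c : {for x, continuous (fun t => g (v t) - g (u t))} by exact: cvgB.
apply: cvgB; apply: cvgM; exact: continuous_dot.
Qed.

Lemma continuous_chord_length (u v : R -> R) (x : R) :
  {for x, continuous u} -> {for x, continuous v} ->
  {for x, continuous (fun t => chord_length (u t) (v t))}.
Proof.
move=> cu cv.
have gu : {for x, continuous (fun t => g (u t))}.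
  by apply: continuous_comp; [|exact: curve_continuous].
have gv : {for x, continuous (fun t => g (v t))}.
  by apply: continuous_comp; [|exact: curve_continuous].
have c : {for x, continuous (fun t => g (v t) - g (u t))} by exact: cvgB.
by apply: (continuous_comp (continuous_dot _ _ _ c c)); exact: sqrt_continuous.
Qed.

Lemma is_derive_chord_left x y : g x <> g y ->
  is_derive x 1 (chord_length^~ y) (- (dot (g1 x) (g y - g x) / chord_length x y)).
Proof.
move=> gxy.
have d : is_derive x 1 (fun t => g y - g t) (- g1 x).
  rewrite -[X in is_derive _ _ _ X]add0r.
  exact: (is_deriveB (is_derive_cst (g y) x 1) (g_der x)).
have c0 : 0 < dot (g y - g x) (g y - g x).
  by apply: dot_gt0; rewrite subr_eq0 eq_sym; apply/eqP.
have h : is_derive x 1 (chord_length^~ y) _ :=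
  is_derive1_comp (is_derive1_sqrt c0) (is_derive_dot d d).
apply: is_derive_eq h _; rewrite !(dotNl, dotNr) [dot (g y - g x) (g1 x)]dotC -/(enorm _).
rewrite -/(chord_length x y).
have := chord_length_gt0 _ _ gxy.
by move=> h; field; rewrite gt_eqF.
Qed.

Lemma is_derive_chord_right x y : g x <> g y ->
  is_derive y 1 (chord_length x) (dot (g1 y) (g y - g x) / chord_length x y).
Proof.
move=> gxy; have := is_derive_chord_left y x (nesym gxy).
have -> : chord_length^~ x = chord_length x by apply/funext => t; exact: chord_lengthC.
move=> h; apply: is_derive_eq h _; rewrite (chord_lengthC y x) -(opprB (g x)) dotNr.
by rewrite mulNr.
Qed.

(* Minus the derivative of [chord_length] in its first argument. *)
Definition chord_cos x y := dot (g1 x) (g y - g x) / chord_length x y.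

Lemma is_derive_chord_cos x y : g x <> g y ->
  is_derive y 1 (chord_cos x) (twist x y / chord_length x y ^+ 3).
Proof.
move=> gxy; have h := chord_length_gt0 _ _ gxy.
have dc : is_derive y 1 (fun t => g t - g x) (g1 y).
  rewrite -[X in is_derive _ _ _ X]subr0.
  exact: (is_deriveB (g_der y) (is_derive_cst (g x) y 1)).
have hN0 : chord_length x y != 0 by rewrite gt_eqF.
have H : is_derive y 1 (chord_cos x) _ :=
  is_deriveM (is_derive_dot (is_derive_cst (g1 x) y 1) dc)
    (is_deriveV hN0 (is_derive_chord_right _ _ gxy)).
apply: is_derive_eq H _; rewrite dot0l add0r /cst /= /GRing.scale /= /twist.
rewrite -!enorm_sqr -/(chord_length x y).
by field.
Qed.

(** The mean value theorem is applied in [x] to the difference of two chord functions, then in [y]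
    to [chord_cos x]. The first application needs only continuity at [a] and [b], so double points
    with [x = a] or [x = b] do no harm; the rectangles used later can have such points on their
    boundary. *)
Lemma mixed_difference a b c d : a < b -> c < d ->
  (forall x y, a < x < b -> c <= y <= d -> g x <> g y) ->
  exists x y, [/\ a < x < b, c < y < d &
    chord_length b d - chord_length a d - (chord_length b c - chord_length a c)
    = - (twist x y / chord_length x y ^+ 3 * (d - c) * (b - a))].
Proof.
move=> ab cd gxy.
pose K := (chord_length^~ d - chord_length^~ c : R -> R).
have cK : {within `[a, b], continuous K}.
  apply: continuous_subspaceT => x; apply: cvgB.
  - apply: (continuous_chord_length id (cst d) x) => //; exact: cst_continuous.
  - apply: (continuous_chord_length id (cst c) x) => //; exact: cst_continuous.
have dK x : x \in `]a, b[ -> is_derive x 1 K (- chord_cos x d - - chord_cos x c).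
  rewrite in_itv /= => xab; apply: is_deriveB; apply: is_derive_chord_left;
  by apply: gxy; rewrite ?lexx ?ltW.
have [x xab Kx] := MVT ab dK cK.
move: xab; rewrite in_itv/= => xab.
have cC : {within `[c, d], continuous (chord_cos x)}.
  apply: derivable_within_continuous => y; rewrite in_itv /= => ycd.
  by case: (is_derive_chord_cos x y (gxy _ _ xab ycd)).
have dC y : y \in `]c, d[ -> is_derive y 1 (chord_cos x) (twist x y / chord_length x y ^+ 3).
  rewrite in_itv /= => /andP[cy yd].
  by apply: is_derive_chord_cos; apply: gxy; rewrite ?(ltW cy) ?(ltW yd).
have [y ycd Cy] := MVT cd dC cC.
exists x, y; split => //.
rewrite -Cy; transitivity (chord_length b d - chord_length b c - (chord_length a d - chord_length a c)).
  by ring.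
by rewrite -[LHS]/(K b - K a) Kx; ring.
Qed.

(** Non-orthogonality of the planes only says that the twist does not vanish; the intermediate value
    theorem carries its sign along paths. *)
Lemma twist_sign_path (u v : R -> R) a b : a <= b ->
  continuous u -> continuous v ->
  (forall t, a <= t <= b -> twist (u t) (v t) <> 0) ->
  0 < twist (u a) (v a) * twist (u b) (v b).
Proof.
move=> ab cu cv tw; rewrite ltNge; apply/negP => neg.
have [||t] := @IVT _ (fun t => twist (u t) (v t)) a b 0 ab.
- by apply: continuous_subspaceT => t; apply: continuous_twist; [exact: cu|exact: cv].
- rewrite ge_min le_max; have [h|/ltW h] := lerP (twist (u a) (v a)) 0.
    have [//|h2] := leP 0 (twist (u b) (v b)); first by rewrite orbT.
    have: twist (u a) (v a) <> 0 by apply: tw; rewrite lexx.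
    by nra.
  have [h2|h2] := leP (twist (u b) (v b)) 0; first by rewrite h orbT.
  have: twist (u a) (v a) <> 0 by apply: tw; rewrite lexx.
  by nra.
by rewrite in_itv/= => tab /tw.
Qed.

End MixedDifference.

(** * Embeddedness and the sign of the twist *)

Lemma segment_in_itv (R : realType) (a b x y t : R) :
  a < x < b -> a < y < b -> 0 <= t <= 1 -> a < x + t * (y - x) < b.
Proof.
move=> /andP[ax xb] /andP[ay yb] /andP[t0 t1].
rewrite -(subr_gt0 a) -(subr_gt0 _ b).
have -> : x + t * (y - x) - a = (1 - t) * (x - a) + t * (y - a) by ring.
have -> : b - (x + t * (y - x)) = (1 - t) * (b - x) + t * (b - y) by ring.
have [->|t0'] := eqVneq t 0; first by rewrite !mul0r !subr0 !mul1r !addr0 !subr_gt0 ax.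
have tp : 0 < t by rewrite lt_def t0'.
by rewrite !ltr_wpDl ?mulr_gt0 ?mulr_ge0 ?subr_ge0 ?subr_gt0 // ltW.
Qed.

(** The bounds on [P] give [3 * s <= |t|], those on [Q] give [3 * |t| <= s]. In the application [s]
    and [t] are the parameter increments to a common point of two transversal branches, and [P], [Q]
    its coordinates in two dual directions. *)
Lemma small_cross_absurd (R : realType) (k s t P Q : R) : 0 < k -> 0 < s ->
  `|P - k * s| <= k / 4 * s -> `|Q| <= k / 4 * s ->
  `|P| <= k / 4 * `|t| -> `|Q - k * t| <= k / 4 * `|t| -> False.
Proof.
move=> k0 s0; rewrite !ler_norml => h1 h2 h3 h4.
have [t0|t0] := leP 0 t; first by rewrite (ger0_norm t0) in h3 h4; nra.
by rewrite (ltr0_norm t0) in h3 h4; nra.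
Qed.

Section LocalGeometry.
Context {R : realType} {n : nat}.
Variables g g1 : R -> 'rV[R]_n.
Hypothesis g_der : forall t : R, is_derive t 1 g (g1 t).
Hypothesis g1_continuous : continuous g1.
Hypothesis g1_unit : forall t, dot (g1 t) (g1 t) = 1.
Hypothesis twist_neq0 : forall x y, g x <> g y -> twist g g1 x y <> 0.

Local Notation chord := (chord_length g).
Local Notation tw := (twist g g1).
Local Notation mixed_diff := (@mixed_difference R n g g1 g_der).

Lemma is_derive_dotr (v : 'rV[R]_n) (x : R) :
  is_derive x 1 (fun t => dot (g t) v) (dot (g1 x) v).
Proof.
apply: is_derive_eq (is_derive_dot (g_der x) (is_derive_cst v x 1)) _.
by rewrite (dotC (g x)) dot0l addr0.
Qed.

Lemma continuous_near_gt (f : R -> R) (x a : R) : {for x, continuous f} -> a < f x ->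
  exists2 e : R, 0 < e & forall y, `|y - x| < e -> a < f y.
Proof.
move=> cf afx; have /nbhs_ballP[e /= e0 he] : nbhs x (fun y => a < f y) by exact: (cvgr_gt (f x) cf a afx).
by exists e => // y yx; apply: he; rewrite /ball/= distrC.
Qed.

Lemma tangent_near (x0 : R) c : c < 1 ->
  exists2 e : R, 0 < e & forall x, `|x - x0| < e -> c < dot (g1 x) (g1 x0).
Proof.
move=> c1; apply: continuous_near_gt; last by rewrite g1_unit.
by apply: continuous_dot; [exact: g1_continuous|exact: cst_continuous].
Qed.

(** Near [x0] the projection on the tangent [g1 x0] has derivative above 1/2. This yields local
    injectivity and bounds parameter differences by projections. *)
Lemma tangent_growth (x0 : R) : exists2 e : R, 0 < e &
  forall x y, `|x - x0| < e -> `|y - x0| < e -> x <= y ->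
    (y - x) / 2 <= dot (g y) (g1 x0) - dot (g x) (g1 x0).
Proof.
have [|e e0 he] := tangent_near x0 2^-1; first by rewrite invf_lt1// ltr1n.
exists e => // x y xe ye xy.
have [||c] := @MVT_segment R (fun t => dot (g t) (g1 x0)) (fun t => dot (g1 t) (g1 x0)) x y xy.
- by move=> t _; exact: is_derive_dotr.
- apply: derivable_within_continuous => t _.
  by case: (is_derive_dotr (g1 x0) t).
rewrite in_itv/= => cxy ->; rewrite mulrC ler_wpM2r ?subr_ge0// ltW// he//.
by move: xe ye; rewrite !ltr_norml; lra.
Qed.

Lemma curve_locally_injective (x0 : R) : exists2 e : R, 0 < e &
  forall x y, `|x - x0| < e -> `|y - x0| < e -> x <> y -> g x <> g y.
Proof.
have [e e0 he] := tangent_growth x0; exists e => // x y xe ye xy gxy.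
have [h|h|//] := ltgtP x y.
- by have := he x y xe ye (ltW h); rewrite gxy; lra.
- by have := he y x ye xe (ltW h); rewrite gxy; lra.
Qed.

Lemma twist_sign_segment x y x' y' :
  (forall t : R, 0 <= t <= 1 -> g (x + t * (x' - x)) <> g (y + t * (y' - y))) ->
  0 < tw x y * tw x' y'.
Proof.
move=> h.
have aff (a b : R) : continuous (fun t : R => a + t * b).
  by move=> t; apply: cvgD; [exact: cvg_cst|apply: cvgM; [exact: cvg_id|exact: cvg_cst]].
have := @twist_sign_path R n g g1 g_der g1_continuous
  (fun t => x + t * (x' - x)) (fun t => y + t * (y' - y)) 0 1 ler01 (aff _ _) (aff _ _).
rewrite !mul0r !mul1r !addr0 ![_ + (_ - _)]addrC !subrK; apply => t t01.
exact/twist_neq0/h.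
Qed.

(** The factor between the mixed difference and the twist is negative. Weak signs suffice, because
    [twist_sign_segment] later compares them with a strict inequality. *)
Lemma mixed_difference_sign a b c d : a < b -> c < d ->
  (forall x y, a < x < b -> c <= y <= d -> g x <> g y) ->
  exists x y, [/\ a < x < b, c < y < d,
    (0 <= chord b d - chord a d - (chord b c - chord a c) -> tw x y <= 0) &
    (chord b d - chord a d - (chord b c - chord a c) <= 0 -> 0 <= tw x y)].
Proof.
move=> ab cd gxy; have [x [y [xab ycd ->]]] := mixed_diff a b c d ab cd gxy.
exists x, y; split => //.
all: have h : 0 < chord x y by apply: chord_length_gt0; apply: gxy => //; case/andP: ycd => [/ltW -> /ltW ->].
all: have p : 0 < chord x y ^- 3 by rewrite invr_gt0 exprn_gt0.
all: have pq : 0 < chord x y ^- 3 * ((d - c) * (b - a)) by rewrite !mulr_gt0// subr_gt0.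
all: rewrite -!mulrA ?oppr_ge0 ?oppr_le0.
- by rewrite pmulr_lle0.
- by rewrite pmulr_lge0.
Qed.

(* Positive twist would reverse the triangle inequality. *)
Lemma twist_near_diagonal (x0 : R) : exists2 e : R, 0 < e &
  forall x y, `|x - x0| < e -> `|y - x0| < e -> x <> y -> tw x y < 0.
Proof.
have [e e0 inj] := curve_locally_injective x0; exists e => //.
suff H x y : `|x - x0| < e -> `|y - x0| < e -> x < y -> tw x y < 0.
  move=> x y xe ye /eqP; rewrite neq_lt => /orP[] h; first exact: H.
  by rewrite twistC; exact: H.
rewrite !ltr_norml => xe ye xy.
(* With [b = c = m] the mixed difference is [chord m y + chord x m - chord x y], nonnegative by the
   triangle inequality. *)
pose m := (x + y) / 2.
have xm : x < m by rewrite /m; lra.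
have my : m < y by rewrite /m; lra.
have [|x1 [y1 [x1e y1e h _]]] := mixed_difference_sign _ _ _ _ xm my.
  move=> s t sI tI; apply: inj; [rewrite ltr_norml; lra|rewrite ltr_norml; lra|lra].
have t1 : tw x1 y1 <= 0.
  apply: h; rewrite chord_lengthxx; have := chord_length_triangle g x m y; lra.
have : 0 < tw x y * tw x1 y1.
  apply: twist_sign_segment => t t01; apply: inj; last by nra.
  - by rewrite ltr_norml; nra.
  - by rewrite ltr_norml; nra.
by nra.
Qed.

(* On the two quadrants above and below [y0] the triangle inequality through
   the double point forces opposite signs of the twist. *)
Lemma double_point_not_isolated x0 y0 e : g x0 = g y0 -> 0 < e ->
  exists x y, [/\ x0 < x < x0 + e, `|y - y0| <= e & g x = g y].
Proof.
move=> g0 e0; apply: contrapT => no.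
have inj x y : x0 < x < x0 + e -> `|y - y0| <= e -> g x <> g y.
  by move=> xe ye gxy; apply: no; exists x, y.
have xe : x0 < x0 + e by lra.
have ye : y0 < y0 + e by lra.
have ye' : y0 - e < y0 by lra.
have [|x1 [y1 [x1e y1e _ h1]]] := mixed_difference_sign _ _ _ _ xe ye.
  by move=> s t sI tI; apply: inj => //; rewrite ler_norml; lra.
have [|x2 [y2 [x2e y2e h2 _]]] := mixed_difference_sign _ _ _ _ xe ye'.
  by move=> s t sI tI; apply: inj => //; rewrite ler_norml; lra.
have c0 : chord x0 y0 = 0 by rewrite /chord_length g0 subrr enorm0.
have cE y : chord x0 y = chord y0 y by rewrite /chord_length g0.
have t1 : 0 <= tw x1 y1.
  apply: h1; rewrite c0 cE.
  by have := chord_length_triangle g (x0 + e) y0 (y0 + e); lra.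
have t2 : tw x2 y2 <= 0.
  apply: h2; rewrite c0 cE.
  by have := chord_length_triangle g (x0 + e) y0 (y0 - e); lra.
have : 0 < tw x1 y1 * tw x2 y2.
  apply: twist_sign_segment => t t01; apply: inj; first exact: segment_in_itv.
  have := segment_in_itv R (y0 - e) (y0 + e) y1 y2 t; rewrite ler_norml; lra.
by nra.
Qed.

Lemma is_derive_littleo (f : R -> R) (x d eta : R) : is_derive x 1 f d -> 0 < eta ->
  exists2 e : R, 0 < e & forall y, `|y - x| < e -> `|f y - f x - d * (y - x)| <= eta * `|y - x|.
Proof.
move=> [df <-] eta0.
have /cvgrPdist_le/(_ _ eta0) := df.
rewrite -/(derive f x 1) => /nbhs_ballP[e /= e0 he].
exists e => // y ye; have [->|yx] := eqVneq y x; first by rewrite !subrr mulr0 subrr normr0 mulr0.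
have hx : y - x != 0 by rewrite subr_eq0.
have := he (y - x); rewrite /ball/= sub0r normrN => /(_ ye hx).
rewrite /GRing.scale/= mulr1 subrK => h.
have -> : f y - f x - 'D_1 f x * (y - x) = - ('D_1 f x - (y - x)^-1 * (f y - f x)) * (y - x).
  by field.
by rewrite normrM normrN ler_wpM2r.
Qed.

(** To first order, two branches with independent tangents meet only at the double point, whereas
    [double_point_not_isolated] yields common points arbitrarily close to it. *)
Lemma double_point_parallel x0 y0 : g x0 = g y0 -> g1 y0 = g1 x0 \/ g1 y0 = - g1 x0.
Proof.
move=> g0; pose w := dot (g1 x0) (g1 y0).
have w1 : w ^+ 2 <= 1 by have := CauchySchwarz_dot (g1 x0) (g1 y0); rewrite !g1_unit mulr1.
have [w2|w2] := eqVneq (w ^+ 2) 1.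
  have : dot (g1 y0 - w *: g1 x0) (g1 y0 - w *: g1 x0) = 0.
    rewrite !(dotBl, dotBr, dotZl, dotZr) (dotC (g1 y0) (g1 x0)) !g1_unit -/w.
    by rewrite -(subrr (w ^+ 2)) {1}w2; ring.
  move=> /dot_eq0/eqP; rewrite subr_eq0 => /eqP yE.
  have : (w - 1) * (w + 1) == 0 by rewrite -subr_sqr expr1n w2 subrr.
  rewrite mulf_eq0 subr_eq0 addr_eq0 => /orP[]/eqP wE; rewrite yE wE ?scale1r ?scaleN1r; by [left|right].
pose k := 1 - w ^+ 2.
have k0 : 0 < k by rewrite subr_gt0 lt_neqAle w2.
have k4 : 0 < k / 4 by rewrite divr_gt0.
(* Up to the factor [k], [E] and [F] are dual to the two tangents. *)
pose E := g1 x0 - w *: g1 y0; pose F := g1 y0 - w *: g1 x0.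
have xE : dot (g1 x0) E = k by rewrite dotBr dotZr g1_unit.
have yE : dot (g1 y0) E = 0 by rewrite dotBr dotZr g1_unit dotC mulr1 subrr.
have yF : dot (g1 y0) F = k by rewrite dotBr dotZr g1_unit dotC.
have xF : dot (g1 x0) F = 0 by rewrite dotBr dotZr g1_unit mulr1 subrr.
have [e1 e10 h1] := is_derive_littleo _ _ _ _ (is_derive_dotr E x0) k4.
have [e2 e20 h2] := is_derive_littleo _ _ _ _ (is_derive_dotr E y0) k4.
have [e3 e30 h3] := is_derive_littleo _ _ _ _ (is_derive_dotr F x0) k4.
have [e4 e40 h4] := is_derive_littleo _ _ _ _ (is_derive_dotr F y0) k4.
pose e := Num.min (Num.min e1 e2) (Num.min e3 e4) / 2.
have m0 : 0 < Num.min (Num.min e1 e2) (Num.min e3 e4) by rewrite !lt_min e10 e20 e30 e40.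
have e0 : 0 < e by rewrite divr_gt0.
have ee : e < Num.min (Num.min e1 e2) (Num.min e3 e4) by rewrite /e; lra.
move: ee; rewrite !lt_min => /andP[/andP[ee1 ee2] /andP[ee3 ee4]].
have [x [y [xe ye gxy]]] := double_point_not_isolated x0 y0 e g0 e0.
have xe' : `|x - x0| < e by rewrite ltr_norml; lra.
have := h1 x (lt_trans xe' ee1); have := h2 y (le_lt_trans ye ee2).
have := h3 x (lt_trans xe' ee3); have := h4 y (le_lt_trans ye ee4).
rewrite xE yE yF xF gxy g0 !mul0r !subr0.
set P := dot (g y) E - _; set Q := dot (g y) F - _.
rewrite (@gtr0_norm _ (x - x0)); last by lra.
move=> H4 H3 H2 H1; exfalso.
by apply: (small_cross_absurd _ _ _ _ _ _ k0 _ H1 H3 H2 H4); lra.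
Qed.

End LocalGeometry.

(** At a maximum point [m] of [|h|] the mean value theorem gives [|h m| <= K * d * |h m|], and
    [K * d < 1]. *)
Lemma gronwall_null (R : realType) (h dh : R -> R) (K d : R) :
  (forall s : R, is_derive s 1 h (dh s)) -> h 0 = 0 -> 0 <= d -> 0 <= K -> K * d < 1 ->
  (forall s, `|s| <= d -> `|dh s| <= K * `|h s|) ->
  forall s, `|s| <= d -> h s = 0.
Proof.
move=> hd h0 d0 K0 Kd hK.
have ch : continuous h.
  by move=> t; apply/differentiable_continuous/derivable1_diffP; case: (hd t).
have cn : {within `[- d, d], continuous (fun s => `|h s|)}.
  by apply: continuous_subspaceT => t; apply: cvg_norm; exact: ch.
have dd : - d <= d by lra.
have [m mI mM] := EVT_max dd cn.
have md : `|m| <= d by move: mI; rewrite in_itv/= ler_norml.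
have [t td hm] : exists2 t, `|t| <= d & `|h m| = `|dh t| * `|m|.
  have [m0|/ltW m0] := leP 0 m.
  - have [|t] := MVT_segment m0 (fun t _ => hd t); first exact: continuous_subspaceT.
    rewrite in_itv/= h0 !subr0 => tI ->; exists t; last by rewrite normrM.
    by move: md; rewrite !ler_norml; lra.
  - have [|t] := MVT_segment m0 (fun t _ => hd t); first exact: continuous_subspaceT.
    rewrite in_itv/= h0 !sub0r => tI hE; exists t; first by move: md; rewrite !ler_norml; lra.
    by rewrite -normrN hE normrM normrN.
have tm : `|h t| <= `|h m| by apply: mM; rewrite in_itv/= -ler_norml.
have hm0 : `|h m| = 0.
  have := hK t td; have := normr_ge0 m; have := normr_ge0 (dh t); have := normr_ge0 (h m).
  move: hm md tm; move: `|h m| `|m| `|dh t| `|h t| => H M D T HE Md TH H0 D0 M0 DT.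
  have : H <= K * H * d.
    by rewrite HE ler_pM// (le_trans DT)// -HE ler_wpM2l.
  by nra.
by move=> s sd; apply/eqP; rewrite -normr_le0 -hm0; apply: mM; rewrite in_itv/= -ler_norml.
Qed.

(** * Double points propagate along the curve *)

Section DoublePoints.
Context {R : realType} {n : nat}.
Variables g g1 g2 : R -> 'rV[R]_n.
Hypothesis g_der : forall t : R, is_derive t 1 g (g1 t).
Hypothesis g1_der : forall t : R, is_derive t 1 g1 (g2 t).
Hypothesis g2_continuous : continuous g2.
Hypothesis g1_unit : forall t, dot (g1 t) (g1 t) = 1.
Hypothesis twist_neq0 : forall x y, g x <> g y -> twist g g1 x y <> 0.

Local Notation chord := (chord_length g).
Local Notation tw := (twist g g1).

Let g1_continuous : continuous g1.
Proof. exact: (curve_continuous g1 g2). Qed.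

(** Since [|p - a|^2 = 2 - 2 * dot p a], the bound [7 / 8] puts [p] and [q] within 1/2 of [a], so
    [|p - q| <= 1]. *)
Lemma unit_vectors_acute (p q a : 'rV[R]_n) : dot p p = 1 -> dot q q = 1 -> dot a a = 1 ->
  7 / 8 < dot p a -> 7 / 8 < dot q a -> 0 < dot p q.
Proof.
move=> p1 q1 a1 pa qa.
have pE : enorm (p - a) <= 2^-1.
  rewrite -(@ler_pXn2r _ 2) ?nnegrE ?enorm_ge0// enorm_sqr.
  by rewrite !(dotBl, dotBr) (dotC a p) p1 a1 expr2; lra.
have qE : enorm (a - q) <= 2^-1.
  rewrite -(@ler_pXn2r _ 2) ?nnegrE ?enorm_ge0// enorm_sqr.
  by rewrite !(dotBl, dotBr) (dotC a q) q1 a1 expr2; lra.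
have : enorm (p - q) ^+ 2 <= 1.
  have := enormD (p - a) (a - q); rewrite subrKA => h.
  by rewrite expr_le1// ?enorm_ge0//; lra.
by rewrite enorm_sqr !(dotBl, dotBr) (dotC q p) p1 q1; lra.
Qed.

(* At a nearest point [y] of the second branch the twist has the sign of the
   product of the tangents, while at [y0] it is, up to [sg], the twist of a
   short chord: if [g x] missed the second branch, the signs would differ. *)
Lemma tangential_branch_covers (x0 y0 sg e : R) : g x0 = g y0 -> sg = 1 \/ sg = -1 ->
  g1 y0 = sg *: g1 x0 -> 0 < e ->
  exists2 d : R, 0 < d & forall x, `|x - x0| < d -> exists2 y, `|y - y0| < e & g x = g y.
Proof.
move=> g0 sgE g1y e0.
have [e1 e10 inj] := curve_locally_injective g g1 g_der g1_continuous g1_unit y0.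
have c78 : 7 / 8 < 1 :> R by lra.
have [e2 e20 tx] := tangent_near g1 g1_continuous g1_unit x0 _ c78.
have [e3 e30 ty] := tangent_near g1 g1_continuous g1_unit y0 _ c78.
have [e4 e40 diag] := twist_near_diagonal g g1 g_der g1_continuous g1_unit twist_neq0 x0.
pose r := Num.min (Num.min e e1) e3 / 2.
have m0 : 0 < Num.min (Num.min e e1) e3 by rewrite !lt_min e0 e10 e30.
have r0 : 0 < r by rewrite divr_gt0.
have : r < Num.min (Num.min e e1) e3 by rewrite /r; lra.
rewrite !lt_min => /andP[/andP[re re1] re3].
(* For [x] near [x0], [g x] is nearer to [g y0] than to the ends [g (y0 - r)] and [g (y0 + r)] of
   the arc, so its nearest point on the arc is interior. *)
have yr s : s = r \/ s = - r -> exists2 d : R, 0 < d &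
    forall x, `|x - x0| < d -> chord x y0 < chord x (y0 + s).
  move=> sr; have sr' : `|s| = r by case: sr => ->; rewrite ?normrN gtr0_norm.
  have [||d d0 hd] := continuous_near_gt (fun x => chord x (y0 + s) - chord x y0) x0 0.
  - by apply: cvgB; apply: (continuous_chord_length g g1 g_der id (cst _)) => //; exact: cst_continuous.
  - rewrite subr_gt0 {1}/chord_length g0 subrr enorm0 /chord_length g0.
    apply: chord_length_gt0; apply: inj; rewrite ?subrr ?normr0// ?(addrC y0) ?addrK ?sr'//.
    by move=> h; move: sr'; rewrite (_ : s = 0) ?normr0; lra.
  by exists d => // x /hd; rewrite subr_gt0.
have [|d1 d10 h1] := yr r; first by left.
have [|d2 d20 h2] := yr (- r); first by right.
exists (Num.min (Num.min d1 d2) (Num.min e2 e4)); first by rewrite !lt_min d10 d20 e20 e40.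
move=> x; rewrite !lt_min => /andP[/andP[xd1 xd2] /andP[xe2 xe4]].
have [->|xx0] := eqVneq x x0; first by exists y0 => //; rewrite subrr normr0.
have yy : y0 - r <= y0 + r by lra.
pose f y := dot (g y - g x) (g y - g x).
have df (y : R) : is_derive y 1 f (2 * dot (g1 y) (g y - g x)).
  have dc : is_derive y 1 (fun t => g t - g x) (g1 y).
    rewrite -[X in is_derive _ _ _ X]subr0.
    exact: (is_deriveB (g_der y) (is_derive_cst (g x) y 1)).
  apply: is_derive_eq (is_derive_dot dc dc) _.
  by rewrite [X in _ + X]dotC; ring.
have cf : {within `[y0 - r, y0 + r], continuous f}.
  by apply: derivable_within_continuous => y _; case: (df y).
have [y yI ymin] := EVT_min yy cf.
have fE z : f z = chord x z ^+ 2 by rewrite enorm_sqr.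
have yI' : y \in `](y0 - r), (y0 + r)[.
  have y0I : y0 \in `[y0 - r, y0 + r] by rewrite in_itv/=; lra.
  have := ymin _ y0I; rewrite !fE => hmin.
  move: yI; rewrite !in_itv/= !le_eqVlt => /andP[/orP[/eqP yE|->] /orP[/eqP yE'|->]] //;
    exfalso; move: hmin; rewrite ?yE' -?yE leNgt => /negP; apply;
    rewrite ltr_pXn2r ?nnegrE ?chord_length_ge0//; first [exact: h1|exact: h2].
have yr' : `|y - y0| < r by move: yI'; rewrite in_itv/= ltr_norml; lra.
exists y; first exact: lt_trans re.
apply: contrapT => gxy.
have f0 : f y != 0.
  by apply/eqP => /dot_eq0/eqP; rewrite subr_eq0 => /eqP/esym.
have crit : dot (g1 y) (g y - g x) = 0.
  have := @derive1_at_min R f (y0 - r) (y0 + r) y yy _ yI' _.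
  move=> [||_ d0].
  - by move=> t _; case: (df t).
  - by move=> t tI; apply: ymin; move: tI; rewrite !in_itv/= => /andP[/ltW -> /ltW ->].
  by case: (df y) => _; rewrite d0 => h; lra.
(* By minimality every point of the arc is at least as far from [g x] as [g y], so the segment from
   [(x, y)] to [(x, y0)] contains no double point. *)
have : 0 < tw x y * tw x y0.
  apply: (twist_sign_segment g g1 g_der g1_continuous twist_neq0) => t t01.
  rewrite subrr mulr0 addr0 => gE.
  have zI : y + t * (y0 - y) \in `[(y0 - r), (y0 + r)].
    have := @segment_in_itv R (y0 - r) (y0 + r) y y0 t; move: yI'; rewrite !in_itv/=.
    by move=> h1' h2'; have := h2' h1' _ t01; lra.
  have := ymin _ zI; rewrite leNgt => /negP; apply.
  by rewrite {1}/f -gE subrr dot0l lt_def f0 dot_ge0.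
have t0 : tw x x0 < 0 by apply: diag => //; [rewrite subrr normr0|apply/eqP].
have -> : tw x y0 = sg * tw x x0.
  by rewrite /twist -g0 g1y dotZr dotZl; ring.
rewrite {1}/twist crit mulr0 subr0.
have s2 : sg * (sg * 1) = 1 by case: sgE => ->; ring.
have fp : 0 < f y by rewrite lt_def f0 dot_ge0.
have h : 0 < sg * dot (g1 x) (g1 y).
  rewrite -dotZr; apply: (unit_vectors_acute _ _ (g1 x0)) => //; last 2 first.
  - exact: tx.
  - by rewrite dotZl -dotZr -g1y; apply: ty; exact: lt_trans re3.
  by rewrite dotZl dotZr g1_unit.
rewrite -/(f y); move: (dot (g1 x) (g1 y)) h (f y) fp => u h v fp.
rewrite (_ : u * v * (sg * tw x x0) = (sg * u) * v * tw x x0); last by ring.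
by have := mulr_gt0 h fp; nra.
Qed.

(* Both arcs are parametrized by arc length: the difference [h] of their
   projections on the common tangent satisfies [`|h'| <= K * `|h|]. *)
Lemma tangential_branches_coincide (x0 y0 sg : R) : g x0 = g y0 -> sg = 1 \/ sg = -1 ->
  g1 y0 = sg *: g1 x0 ->
  exists2 d : R, 0 < d & forall s, `|s| < d ->
    g (x0 + s) = g (y0 + sg * s) /\ g1 (y0 + sg * s) = sg *: g1 (x0 + s).
Proof.
move=> g0 sgE g1y.
have s2 : sg * sg = 1 by case: sgE => ->; ring.
have sN (s : R) : `|sg * s| = `|s| by case: sgE => ->; rewrite ?mulN1r ?normrN ?mul1r.
pose E := g1 x0.
(* [A] and [B] project the two branches on the common tangent [E], the second branch being run
   through in the direction of the first; [b] is the derivative of [B]. *)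
pose B s := dot (g (y0 + sg * s)) E.
pose b s := sg * dot (g1 (y0 + sg * s)) E.
pose b' s := dot (g2 (y0 + sg * s)) E.
have aff (s : R) : is_derive s 1 (fun s : R => y0 + sg * s) sg.
  rewrite -[X in is_derive _ _ _ X]add0r.
  apply: is_deriveD; apply: is_derive_eq (is_deriveZ sg (is_derive_id s 1)) _.
  by rewrite /GRing.scale/= mulr1.
have dB (s : R) : is_derive s 1 B (b s).
  have h : is_derive s 1 B _ := @is_derive1_comp R (fun t => dot (g t) E)
    (fun s : R => y0 + sg * s) s _ _ (is_derive_dotr g g1 g_der E (y0 + sg * s)) (aff s).
  by apply: is_derive_eq h _; rewrite mulrC.
have db (s : R) : is_derive s 1 b (b' s).
  have h : is_derive s 1 b _ := is_deriveZ sg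
    (@is_derive1_comp R (fun t => dot (g1 t) E)
      (fun s : R => y0 + sg * s) s _ _ (is_derive_dotr g1 g2 g1_der E (y0 + sg * s)) (aff s)).
  by apply: is_derive_eq h _; rewrite /GRing.scale/= mulrCA s2 mulr1.
pose A s := dot (g (x0 + s)) E.
have dA (s : R) : is_derive s 1 A (dot (g1 (x0 + s)) E).
  have sh : is_derive s 1 (fun s : R => x0 + s) 1.
    rewrite -[X in is_derive _ _ _ X]add0r.
    exact: is_deriveD (is_derive_cst x0 s 1) (is_derive_id s 1).
  have h : is_derive s 1 A _ := @is_derive1_comp R (fun t => dot (g t) E)
    (fun s : R => x0 + s) s _ _ (is_derive_dotr g g1 g_der E (x0 + s)) sh.
  by apply: is_derive_eq h _; rewrite mulr1.
have cb' : continuous b'.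
  move=> s; apply: continuous_dot; last exact: cst_continuous.
  apply: continuous_comp; last exact: g2_continuous.
  by apply/differentiable_continuous/derivable1_diffP; case: (aff s).
(* [C] bounds [|b'|] near 0, so it is a Lipschitz constant of [b] there. *)
pose C := `|b' 0| + 1.
have C0 : 0 < C by rewrite ltr_wpDl.
have [||e1 e10 bC] := continuous_near_gt (fun s => - `|b' s|) 0 (- C).
- by apply: cvgN; apply: cvg_norm; exact: cb'.
- by rewrite ltrN2 /C ltrDl.
have [e2 e20 grow] := tangent_growth g g1 g_der g1_continuous g1_unit y0.
have h0 : 0 < 1 :> R by [].
have [e3 e30 tx] := tangent_near g1 g1_continuous g1_unit x0 0 h0.
have [e4 e40 ty] := tangent_near g1 g1_continuous g1_unit y0 0 h0.
pose e := Num.min (Num.min e1 e2) e4.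
have e0 : 0 < e by rewrite !lt_min e10 e20 e40.
have [d d0 cover] := tangential_branch_covers x0 y0 sg e g0 sgE g1y e0.
have bLip (s t : R) : `|s| < e1 -> `|t| < e1 -> `|b t - b s| <= C * `|t - s|.
  wlog st : s t / s <= t => [W se te|].
    have [/W|/ltW/W] := leP s t; first exact.
    by move=> /(_ te se); rewrite distrC [`|s - t|]distrC.
  move=> se te; have [|u uI ->] := MVT_segment st (fun u _ => db u).
    by apply: derivable_within_continuous => u _; case: (db u).
  rewrite normrM ler_wpM2r// -lerN2 ltW// bC// subr0.
  by move: uI se te; rewrite in_itv/= !ltr_norml; lra.
have grow2 (s t : R) : `|s| < e2 -> `|t| < e2 -> `|t - s| <= 2 * `|B t - B s|.
  wlog st : s t / sg * s <= sg * t => [W se te|].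
    have [/W|/ltW/W] := leP (sg * s) (sg * t); first exact.
    by move=> /(_ te se); rewrite distrC [`|B s - _|]distrC.
  move=> se te; have := grow (y0 + sg * s) (y0 + sg * t).
  rewrite ![y0 + _ - y0]addrAC !subrr !add0r !sN lerD2l => /(_ se te st).
  rewrite -(sN (t - s)) mulrBr opprD addrACA subrr add0r g1y !dotZr -/E -/(B t) -/(B s).
  rewrite -mulrBr => h; rewrite ger0_norm; last by rewrite mulrBr subr_ge0.
  by have := ler_norm (sg * (B t - B s)); rewrite sN; lra.
(* If [t] is the parameter of [g (x0 + s)] on the second branch, the derivative of [A - B] at [s] is
   [b t - b s], at most [C * |t - s| <= 2 * C * |A s - B s|] in absolute value. *)
pose K := 2 * C.
pose r := Num.min (Num.min d e) (Num.min e3 K^-1) / 2.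
have K0 : 0 < K by rewrite mulr_gt0.
have m0 : 0 < Num.min (Num.min d e) (Num.min e3 K^-1) by rewrite !lt_min d0 e10 e20 e40 e30 invr_gt0.
have r0 : 0 < r by rewrite divr_gt0.
have : r < Num.min (Num.min d e) (Num.min e3 K^-1) by rewrite /r; lra.
rewrite !lt_min => /andP[/andP[rd /andP[/andP[re1 re2] re4]] /andP[re3 rK]].
(* The tangents at the common point agree up to sign by [double_point_parallel]. The sign is [sg],
   because each tangent makes an acute angle with the one at [x0], respectively [y0]. *)
have lift (s : R) : `|s| <= r -> exists t : R, [/\ `|t| < e, g (x0 + s) = g (y0 + sg * t),
    g1 (y0 + sg * t) = sg *: g1 (x0 + s) & `|t - s| <= 2 * `|A s - B s|].
  move=> sr; have [|y yE gxy] := cover (x0 + s).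
    by rewrite [x0 + _]addrC addrK; exact: le_lt_trans rd.
  have yE' : y0 + sg * (sg * (y - y0)) = y by rewrite mulrA s2 mul1r addrC subrK.
  move: (yE); rewrite !lt_min => /andP[/andP[ye1 ye2] ye4].
  exists (sg * (y - y0)); rewrite yE' sN; split => //.
  - have tp : 0 < dot (g1 (x0 + s)) (g1 x0).
      by apply: tx; rewrite addrAC subrr add0r; exact: le_lt_trans re3.
    have := ty y ye4; rewrite g1y dotZr.
    have [->|->] := double_point_parallel g g1 g_der g1_continuous g1_unit twist_neq0 _ _ gxy.
      by case: sgE => ->; rewrite ?scale1r// mulN1r oppr_gt0 => /(lt_trans tp); rewrite ltxx.
    case: sgE => ->; rewrite ?scaleN1r// mul1r dotNl oppr_gt0 => /(lt_trans tp).
    by rewrite ltxx.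
  - have -> : A s = B (sg * (y - y0)) by rewrite /A /B yE' gxy.
    by apply: grow2; rewrite ?sN//; apply: le_lt_trans re2.
have hnull := @gronwall_null R (A - B) (fun s => dot (g1 (x0 + s)) E - b s) K r.
have {}hnull (s : R) : `|s| <= r -> A s - B s = 0.
  apply: hnull => //; [|by rewrite ltW|by rewrite ltW| |].
  - rewrite -![(_ - _ : _ -> _) _]/(_ - _) /A /B mulr0 !addr0 g0 subrr//.
  - by rewrite mulrC -ltr_pdivlMr// div1r.
  - move=> {}s sr; have [t [te gE g1E ts]] := lift s sr.
    move: te; rewrite !lt_min => /andP[/andP[te1 _] _].
    have -> : dot (g1 (x0 + s)) E = b t by rewrite /b g1E dotZl mulrA s2 mul1r.
    apply: le_trans (bLip s t _ te1) _; first exact: le_lt_trans re1.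
    by rewrite /K (mulrC 2) -mulrA ler_wpM2l// ltW.
exists r => // s /ltW sr; have [t [_ gE g1E]] := lift s sr.
rewrite hnull// normr0 mulr0 normr_le0 subr_eq0 => /eqP tsE.
by rewrite tsE in gE g1E.
Qed.

(** The set of [s] at which the branches agree together with their tangents is open by
    [tangential_branches_coincide], closed by continuity, and contains 0, so it is the whole line.
    For [sg = 1] this is periodicity. *)
Lemma double_point_periodic (x0 y0 : R) : g x0 = g y0 -> x0 <> y0 -> periodic g (y0 - x0).
Proof.
move=> g0 xy0.
have [sg [sgE g1y]] : exists sg : R, (sg = 1 \/ sg = -1) /\ g1 y0 = sg *: g1 x0.
  have [->|->] := double_point_parallel g g1 g_der g1_continuous g1_unit twist_neq0 _ _ g0.
  - by exists 1; rewrite scale1r; split => //; left.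
  - by exists (-1); rewrite scaleN1r; split => //; right.
pose W := [set s : R | g (x0 + s) = g (y0 + sg * s) /\ g1 (y0 + sg * s) = sg *: g1 (x0 + s)].
have caff (a b : R) : continuous (fun s : R => a + b * s).
  by move=> t; apply: cvgD; [exact: cvg_cst|apply: cvgM; [exact: cvg_cst|exact: cvg_id]].
have cg := curve_continuous g g1 g_der.
have cs (f : R -> 'rV[R]_n) (a b : R) : continuous f -> continuous (fun s => f (a + b * s)).
  by move=> cf s; apply: continuous_comp; [exact: caff|exact: cf].
have Wopen : open W.
  rewrite openE => s [gs g1s].
  have [d d0 hd] := tangential_branches_coincide (x0 + s) (y0 + sg * s) sg gs sgE g1s.
  apply/nbhs_ballP; exists d => //= t; rewrite /ball/= distrC => /hd.
  by rewrite -!addrA -mulrDr [s + _]addrC subrK.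
have Wclosed : closed W.
  have -> : W = ((fun s => g (x0 + 1 * s) - g (y0 + sg * s)) @^-1` [set 0]) `&`
     ((fun s => g1 (y0 + sg * s) - sg *: g1 (x0 + 1 * s)) @^-1` [set 0]).
    apply/seteqP; split=> s /=; rewrite mul1r.
    - by move=> [gE g1E]; split; apply/eqP; rewrite subr_eq0 ?gE ?g1E.
    - by move=> [/eqP + /eqP]; rewrite !subr_eq0 => /eqP ? /eqP ?.
  apply: closedI; apply: preimage_closed.
  - by move=> s _; apply: cvgB; exact: cs.
  - exact: (accessible_closed_set1 (hausdorff_accessible (@norm_hausdorff R _))).
  - by move=> s _; apply: cvgB; [exact: cs|apply: cvgZr; exact: cs].
  - exact: (accessible_closed_set1 (hausdorff_accessible (@norm_hausdorff R _))).
have WT : W = setT.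
  have cT : connected ([set: R]) by apply/connected_intervalP.
  apply: cT.
  - by exists 0; rewrite /W /= mulr0 !addr0.
  - by exists W => //; rewrite setTI.
  - by exists W => //; rewrite setTI.
have {}WT s : g (x0 + s) = g (y0 + sg * s) /\ g1 (y0 + sg * s) = sg *: g1 (x0 + s).
  by have : W s by rewrite WT.
case: sgE => sE; rewrite sE in WT.
- move=> u; have [+ _] := WT (u - x0); rewrite (addrC x0) subrK => ->.
  by congr g; ring.
(* For [sg = -1] the branches run towards each other and meet halfway, where [g1 t = - g1 t]. *)
- have [_] := WT ((y0 - x0) / 2).
  have -> : y0 + -1 * ((y0 - x0) / 2) = x0 + (y0 - x0) / 2 by field.
  set t := x0 + _; rewrite scaleN1r => h.
  have := g1_unit t; rewrite {1}h dotNl g1_unit => k.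
  by have := @ltrN10 R; rewrite k ltr10.
Qed.

(** A double point in the strip [x < y < x + L] would give a period below [L]. So the twist does not
    vanish there, and the sign found near the diagonal spreads along segments. *)
Lemma twist_lt0 (L : R) : (forall T : R, 0 < T < L -> ~ periodic g T) ->
  forall x y, x < y < x + L -> tw x y < 0.
Proof.
move=> np x y xy.
have inj (s t : R) : s < t < s + L -> g s <> g t.
  move=> st gst; apply: (np (t - s)); first by lra.
  by apply: double_point_periodic => // stE; rewrite stE in st; lra.
have [e e0 diag] := twist_near_diagonal g g1 g_der g1_continuous g1_unit twist_neq0 x.
pose z := x + Num.min e L / 2.
have m0 : 0 < Num.min e L by rewrite lt_min e0; lra.
have m2 : Num.min e L / 2 < Num.min e L by lra.
move: (m2); rewrite lt_min => /andP[me mL].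
have txz : tw x z < 0.
  apply: diag; rewrite ?subrr ?normr0// /z; last by lra.
  by rewrite addrAC subrr add0r gtr0_norm//; lra.
have : 0 < tw x y * tw x z.
  apply: (twist_sign_segment g g1 g_der g1_continuous twist_neq0) => t t01.
  rewrite subrr mulr0 addr0; apply: inj; apply: segment_in_itv => //.
  by rewrite /z; lra.
by nra.
Qed.

End DoublePoints.

Lemma sum_ord_head {V : nmodType} (F : nat -> V) q : (0 < q)%N ->
  \sum_(k < q) F k = F 0%N + \sum_(k < q.-1) F k.+1.
Proof. by case: q => // q _; rewrite big_ord_recl. Qed.

Lemma sum_ord_last {V : nmodType} (F : nat -> V) q : (0 < q)%N ->
  \sum_(k < q) F k = \sum_(k < q.-1) F k + F q.-1.
Proof. by case: q => // q _; rewrite big_ord_recr. Qed.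

(** * Exchange arguments on polygons *)

Section PolygonExchange.
Context {R : realType}.
Variables (h : R -> R -> R) (L : R).
Hypothesis L_gt0 : 0 < L.
Hypothesis hC : forall x y, h x y = h y x.
Hypothesis hxx : forall x, h x x = 0.
Hypothesis h_periodic : forall x y, h x (y + L) = h x y.
Hypothesis h_quadrangle : forall a b c d, a < b -> b <= c -> c < d -> d <= a + L ->
  h a d + h b c < h a c + h b d.

Definition polygon_length (q : nat) (x : nat -> R) := \sum_(i < q) h (x i) (x i.+1).

(** A polygon unrolled to an infinite sequence, so that indices can be shifted; the closing
    condition becomes quasi-periodicity. *)
Definition periodic_polygon (p q : nat) (x : nat -> R) :=
  (forall i, 0 <= x i.+1 - x i <= L) /\ (forall i, x (i + q)%N = x i + p%:R * L).

(** The competitors are finite polygons, so a single vertex can be moved without its translates. *)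
Definition longest_polygon (p q : nat) (x : nat -> R) :=
  periodic_polygon p q x /\
  (forall x', inscribed_polygon L p q x' -> polygon_length q x' <= polygon_length q x).

Lemma h_periodicr x y k : h x (y + k%:R * L) = h x y.
Proof.
elim: k => [|k IH]; first by rewrite mul0r addr0.
by rewrite -addn1 natrD mulrDl mul1r addrA h_periodic.
Qed.

Lemma h_periodicl x y k : h (x + k%:R * L) y = h x y.
Proof. by rewrite hC h_periodicr hC. Qed.

Lemma h_quadrangle_le a b c d : a <= b -> b <= c -> c <= d -> d <= a + L ->
  h a d + h b c <= h a c + h b d.
Proof.
rewrite le_eqVlt => /predU1P[-> *|ab bc]; first by rewrite addrC.
rewrite le_eqVlt => /predU1P[->//|cd da].
exact/ltW/h_quadrangle.
Qed.

Lemma periodic_polygonM p q x i k : periodic_polygon p q x ->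
  x (i + k * q)%N = x i + k%:R * (p%:R * L).
Proof.
move=> [_ xq]; elim: k => [|k IH]; first by rewrite mul0n addn0 mul0r addr0.
by rewrite mulSn addnCA addnC xq IH -addn1 natrD mulrDl mul1r addrA.
Qed.

Lemma eq_polygon_length q x x' : (forall i, (i <= q)%N -> x i = x' i) ->
  polygon_length q x = polygon_length q x'.
Proof. by move=> xx'; apply: eq_bigr => i _; rewrite !xx'// ltnW. Qed.

Lemma inscribed_polygon_unroll p q x : (0 < q)%N -> inscribed_polygon L p q x ->
  exists x', periodic_polygon p q x' /\ forall i, (i <= q)%N -> x' i = x i.
Proof.
move=> q0 [xs xq]; exists (fun i => x (i %% q)%N + (i %/ q)%:R * (p%:R * L)); split.
  split => i.
  - have iq : (i %% q < q)%N by rewrite ltn_mod.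
    have -> : (i.+1 %/ q = i %/ q + (i %% q).+1 %/ q)%N.
      by rewrite {1}(divn_eq i q) -addnS divnMDl.
    have -> : (i.+1 %% q = (i %% q).+1 %% q)%N.
      by rewrite {1}(divn_eq i q) -addnS modnMDl.
    have := xs _ iq; case: (ltngtP (i %% q).+1 q) => [iq'|iq'|iq'].
    + rewrite (modn_small iq') (divn_small iq') addn0; lra.
    + by move: iq'; rewrite ltnS leqNgt iq.
    + rewrite iq' modnn divnn q0 xq natrD mulrDl mul1r; lra.
  - by rewrite modnDr divnDr// divnn q0 natrD mulrDl mul1r addrA.
move=> i; rewrite leq_eqVlt => /predU1P[->|iq].
- by rewrite modnn divnn q0 mul1r xq.
- by rewrite (modn_small iq) (divn_small iq) mul0r addr0.
Qed.

Lemma periodic_polygon_shift p q x k : periodic_polygon p q x ->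
  periodic_polygon p q (fun i => x (i + k)%N).
Proof. by move=> [xs xq]; split=> i; rewrite ?addSn// addnAC xq. Qed.

Lemma polygon_length_shift p q x k : periodic_polygon p q x ->
  polygon_length q (fun i => x (i + k)%N) = polygon_length q x.
Proof.
move=> [xs xq]; elim: k => [|k IH].
  by apply: eq_polygon_length => i _; rewrite addn0.
rewrite -IH /polygon_length; case: q xq {IH} => [|q] xq; first by rewrite !big_ord0.
rewrite big_ord_recr [RHS]big_ord_recl /= addrC; congr (_ + _).
  rewrite add0n add1n -addSnnS [(q.+1 + k)%N]addnC xq.
  by rewrite [(q.+1 + k.+1)%N]addnC xq h_periodicl h_periodicr.
by apply: eq_bigr => i _; rewrite /bump /= add1n !addSn !addnS.
Qed.

Lemma periodic_polygon_translate p q x k : periodic_polygon p q x ->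
  periodic_polygon p q (fun i => x i + k%:R * L).
Proof.
move=> [xs xq]; split=> i; last by rewrite xq addrAC.
by rewrite opprD addrACA subrr addr0.
Qed.

Lemma polygon_length_translate q x k :
  polygon_length q (fun i => x i + k%:R * L) = polygon_length q x.
Proof. by apply: eq_bigr => i _; rewrite h_periodicl h_periodicr. Qed.

Lemma longest_polygon_shift p q x k : longest_polygon p q x ->
  longest_polygon p q (fun i => x (i + k)%N).
Proof.
move=> [px mx]; split; first exact: periodic_polygon_shift.
by move=> x'; rewrite (polygon_length_shift p)//; exact: mx.
Qed.

Lemma longest_polygon_translate p q x k : longest_polygon p q x ->
  longest_polygon p q (fun i => x i + k%:R * L).
Proof.
move=> [px mx]; split; first exact: periodic_polygon_translate.
by move=> x'; rewrite polygon_length_translate; exact: mx.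
Qed.

(** After a shift by [i] the moved vertex has index 1, which is not an end as [1 < q]; so the
    closing condition survives. The bounds on [w] keep both adjacent steps in [[0, L]]. *)
Lemma longest_polygon_vertex p q x i w : (1 < q)%N -> longest_polygon p q x ->
  x i <= w <= x i + L -> x i.+2 - L <= w <= x i.+2 ->
  h (x i) w + h w (x i.+2) <= h (x i) (x i.+1) + h (x i.+1) (x i.+2).
Proof.
move=> q1 /(longest_polygon_shift _ _ _ i)[[zs zq] zmax] w1 w2.
pose z k := x (k + i)%N.
pose z' k := if k == 1%N then w else z k.
have z'P : inscribed_polygon L p q z'.
  split => [k kq|]; last by rewrite /z' eq_sym ltn_eqF// -(zq 0%N).
  by rewrite /z'; case: k {kq} => [|[|k]] /=; rewrite /z ?add0n ?add1n ?add2n; [lra|lra|exact: zs].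
have := zmax _ z'P; rewrite -/z /polygon_length.
case: q q1 {zs zq zmax z'P} => [|[|q]]// _.
by rewrite !big_ord_recl /= /z' /z /= !add1n add0n; lra.
Qed.

(** Otherwise [P] would propagate upwards from [i] to [j + i * q], and by periodicity hold at
    [j]. *)
Lemma periodic_pred_switch (q : nat) (P : nat -> Prop) i j : (0 < q)%N ->
  (forall k, P (k + q)%N <-> P k) -> P i -> ~ P j -> exists k, P k /\ ~ P k.+1.
Proof.
move=> q0 Pq Pi nPj.
have PqM k m : P (k + m * q)%N <-> P k.
  by elim: m => [|m IH]; rewrite ?mul0n ?addn0// mulSn addnCA addnC Pq.
apply: contrapT => no; apply: nPj; apply/(PqM j i).
have all_up m : P (i + m)%N.
  elim: m => [|m IH]; first by rewrite addn0.
  by rewrite addnS; apply: contrapT => nP; apply: no; exists (i + m)%N.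
have -> : (j + i * q = i + (j + i * q - i))%N by rewrite subnKC// (leq_trans (leq_pmulr i q0))// leq_addl.
exact: all_up.
Qed.

(* A repeated vertex could be moved between its neighbours, with a gain by the
   quadrangle inequality. *)
Lemma longest_polygon_step_neq0 p q x i : (0 < p)%N -> (1 < q)%N ->
  longest_polygon p q x -> x i < x i.+1.
Proof.
move=> p0 q1 mx; have [[xs xq] _] := mx.
have le0 k : x k <= x k.+1 by rewrite -subr_ge0; case/andP: (xs k).
rewrite lt_def le0 andbT; apply/eqP => xi.
have [j xj] : exists j, x j.+1 <> x j.
  apply: contrapT => no; have xc k : x k = x 0%N.
    elim: k => // k <-; apply: contrapT => h'; apply: no; by exists k.
  have := xq 0%N; rewrite !xc -[LHS]addr0 => /addrI/esym/eqP.
  by rewrite mulf_eq0 pnatr_eq0 (gt_eqF L_gt0) orbF => /eqP p1; rewrite p1 in p0.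
have [|k [xk xk1]] := periodic_pred_switch q (fun k => x k.+1 = x k) i j (ltnW q1) _ xi xj.
  by move=> k; rewrite -addSn !xq; split => [/addIr|->].
have lt1 : x k < x k.+2.
  by rewrite -xk lt_def le0 andbT; apply/eqP.
have := xs k.+1; rewrite xk => s1.
pose w := (x k + x k.+2) / 2.
have := longest_polygon_vertex p q x k w q1 mx; rewrite xk hxx add0r /w.
have := h_quadrangle (x k) w w (x k.+2); rewrite hxx addr0 -/w.
have w1 : x k < w by rewrite /w; lra.
have w2 : w < x k.+2 by rewrite /w; lra.
move=> /(_ w1 (lexx _) w2) Q V.
have : x k.+2 <= x k + L by lra.
by move=> /Q; apply/negP; rewrite -leNgt; apply: V; lra.
Qed.

(** On the closed curve a step [L] is also a repeated vertex. As [p < q], some full step is followed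
    by a shorter one; moving their common vertex back into the gap between [x k.+2 - L] and [x k.+1]
    gives a gain by the quadrangle inequality. *)
Lemma longest_polygon_step_ltL p q x i : (0 < p)%N -> (p < q)%N ->
  longest_polygon p q x -> x i.+1 < x i + L.
Proof.
move=> p0 pq mx; have [[xs xq] _] := mx.
have q1 : (1 < q)%N by exact: leq_ltn_trans pq.
have leL k : x k.+1 <= x k + L by have := xs k; lra.
rewrite lt_neqAle leL andbT; apply/eqP => xi.
have [j xj] : exists j, x j.+1 <> x j + L.
  apply: contrapT => no; have xc k : x k = x 0%N + k%:R * L.
    elim: k => [|k IH]; first by rewrite mul0r addr0.
    rewrite -addn1 natrD mulrDl mul1r addrA -IH addn1.
    by apply: contrapT => h'; apply: no; exists k.
  have := xq 0%N; rewrite (xc (0 + q)%N) => /addrI/(mulIf (lt0r_neq0 L_gt0))/eqP.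
  rewrite eqr_nat => /eqP qp.
  by rewrite -qp add0n ltnn in pq.
have [|k [xk xk1]] := periodic_pred_switch q (fun k => x k.+1 = x k + L) i j (ltnW q1) _ xi xj.
  by move=> k; rewrite -addSn !xq addrAC; split => [/addIr|->].
have lt1 : x k.+2 < x k.+1 + L by rewrite lt_neqAle leL andbT; apply/eqP.
have lt0 := longest_polygon_step_neq0 p q x k.+1 p0 q1 mx.
pose w := (x k.+1 + (x k.+2 - L)) / 2.
have w1 : x k.+2 < w + L by rewrite /w; lra.
have w2 : w + L < x k.+1 + L by rewrite /w; lra.
have w3 : x k.+1 + L <= x k.+2 + L by lra.
have := h_quadrangle _ _ _ _ w1 (lexx _) w2 w3.
rewrite hxx !h_periodic (hC (w + L)) h_periodic addr0.
have := longest_polygon_vertex p q x k w q1 mx.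
have hk y : h (x k) y = h (x k.+1) y by rewrite xk hC [RHS]hC h_periodic.
rewrite !hk hxx add0r (hC w) (hC (x k.+2) (x k.+1)) => V Q.
suff : h (x k.+1) w + h (x k.+2) w <= h (x k.+1) (x k.+2) by lra.
by apply: V; rewrite /w; lra.
Qed.

(* [z_i] and its shift [z_(i+q) - p L] cross, because their difference is
   [q]-antiperiodic; exchanging tails at a crossing disconnects [z]. *)
Lemma polygon_halving p q z : (0 < q)%N -> inscribed_polygon L (p + p) (q + q) z ->
  exists a b, [/\ inscribed_polygon L p q a, inscribed_polygon L p q b &
    polygon_length (q + q) z <= polygon_length q a + polygon_length q b].
Proof.
move=> q0 iz; have qq0 : (0 < q + q)%N by rewrite addn_gt0 q0.
have [z' [pz' z'E]] := inscribed_polygon_unroll _ _ _ qq0 iz.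
rewrite -(eq_polygon_length _ _ _ z'E) {iz z'E} => {z}.
pose f (z : nat -> R) i := z i - (z (i + q)%N - p%:R * L).
have fq i : f z' (i + q)%N = - f z' i.
  have [_ zq] := pz'; rewrite /f -addnA zq natrD mulrDl; ring.
(* If [f] never passed from nonpositive to nonnegative, it would stay nonpositive once it is,
   although it changes sign after [q] steps. *)
have [i [fi fi1]] : exists i, f z' i <= 0 /\ 0 <= f z' i.+1.
  have [i0 fi0] : exists i0, f z' i0 <= 0.
    have [f0|/ltW f0] := leP (f z' 0%N) 0; first by exists 0%N.
    by exists (0 + q)%N; rewrite fq oppr_le0.
  apply: contrapT => no.
  have neg k : f z' (i0 + k)%N <= 0.
    elim: k => [|k IH]; first by rewrite addn0.
    rewrite addnS leNgt; apply/negP => /ltW fk; apply: no.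
    by exists (i0 + k)%N.
  apply: no; exists (i0 + q.-1)%N; split => //.
  by rewrite -addnS prednK// fq oppr_ge0.
rewrite -(polygon_length_shift _ _ _ i pz').
have := periodic_polygon_shift _ _ _ i pz'.
set z := fun k => z' (k + i)%N => -[zs zq].
have {fi} f0 : z 0%N <= z q - p%:R * L by move: fi; rewrite /f subr_le0 addnC.
have {fi1} f1 : z q.+1 - p%:R * L <= z 1%N.
  by move: fi1; rewrite /f subr_ge0 /z add1n addSn addnC -addSn addnC.
have s0 := zs 0%N; have sq := zs q.
have zqq : z (q + q)%N = z 0%N + (p + p)%:R * L by rewrite -(zq 0%N).
(* [a] runs through [z_1, ..., z_q] and [b] through [z_(q+1), ..., z_(2q)], each then closing up.
   The sides from [z_0] to [z_1] and from [z_q] to [z_(q+1)] are traded, modulo [p] turns, for those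
   from [z_0] to [z_(q+1)] and from [z_q] to [z_1]. *)
pose a k := if (k < q)%N then z k.+1 else z 1%N + p%:R * L.
pose b k := if (k < q)%N then z (q + k.+1)%N else z q.+1 + p%:R * L.
exists a, b.
have quad := h_quadrangle_le (z 0%N) (z q - p%:R * L) (z q.+1 - p%:R * L) (z 1%N).
split.
- split => [k kq|]; last by rewrite /a ltnn q0.
  rewrite /a kq; case: ltnP => kq1; first exact: zs.
  have -> : k.+1 = q by apply/eqP; rewrite eqn_leq kq.
  lra.
- split => [k kq|]; last by rewrite /b ltnn q0 addn1.
  rewrite /b kq; case: ltnP => kq1; first by rewrite !addnS; exact: zs.
  have -> : k.+1 = q by apply/eqP; rewrite eqn_leq kq.
  by rewrite zqq natrD mulrDl; lra.
have hT u v : h (u - p%:R * L) v = h u v by rewrite -(h_periodicl (u - _) v p) subrK.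
have hT' u v : h u (v - p%:R * L) = h u v by rewrite hC hT hC.
rewrite !hT !hT' in quad.
rewrite {1}/polygon_length big_split_ord /=.
rewrite (sum_ord_head (fun k => h (z k) (z k.+1)))//.
rewrite (sum_ord_head (fun k => h (z (q + k)%N) (z (q + k).+1)))// addn0.
rewrite /polygon_length.
rewrite (sum_ord_last (fun k => h (a k) (a k.+1)))//.
rewrite (sum_ord_last (fun k => h (b k) (b k.+1)))//.
have aE k : (k < q)%N -> a k = z k.+1 by move=> kq; rewrite /a kq.
have bE k : (k < q)%N -> b k = z (q + k.+1)%N by move=> kq; rewrite /b kq.
have q1 : (q.-1 < q)%N by rewrite prednK.
have aq : a q = z 1%N + p%:R * L by rewrite /a ltnn.
have bq : b q = z q.+1 + p%:R * L by rewrite /b ltnn.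
clearbody a b.
have -> : \sum_(k < q.-1) h (a k) (a k.+1) = \sum_(k < q.-1) h (z k.+1) (z k.+2).
  apply: eq_bigr => k _; have kq : (k.+1 < q)%N by rewrite -ltn_predRL.
  by rewrite (aE _ kq) (aE _ (ltnW kq)).
have -> : \sum_(k < q.-1) h (b k) (b k.+1) = \sum_(k < q.-1) h (z (q + k.+1)%N) (z (q + k.+1).+1).
  apply: eq_bigr => k _; have kq : (k.+1 < q)%N by rewrite -ltn_predRL.
  by rewrite (bE _ kq) (bE _ (ltnW kq)) !addnS.
rewrite (aE _ q1) (bE _ q1) prednK// aq bq zqq h_periodicr h_periodicl h_periodicr.
move: quad; clear -f0 f1 s0 sq => quad; lra.
Qed.

(** Per step, [y] advances less than [x] on average. Translated by enough turns to be ahead of [x]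
    at index 1, it is overtaken at some step, and there its side lies inside that of [x]. Starting
    at index 1 leaves room for the vertex [x i] before the nested sides. *)
Lemma nested_steps p m m' x y : (0 < p)%N -> (0 < m)%N -> (m < m')%N ->
  periodic_polygon p m x -> periodic_polygon p m' y ->
  exists i k, x i.+1 <= y i.+1 + k%:R * L /\ y i.+2 + k%:R * L < x i.+2.
Proof.
move=> p0 m0 mm' px py; apply: contrapT => no.
have [k hk] : exists k : nat, x 1%N - y 1%N <= k%:R * L.
  exists (Num.truncn (`|x 1%N - y 1%N| / L)).+1.
  by rewrite -ler_pdivrMr// (le_trans (ler_wpM2r _ (ler_norm _))) ?invr_ge0 ?ltW// truncnS_gt.
have step i : x i.+1 <= y i.+1 + k%:R * L.
  elim: i => [|i IH]; first by lra.
  by rewrite leNgt; apply/negP => h'; apply: no; exists i, k.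
(* [N] exceeds the lead of [y] and [c * L > 1]. In [N * c * m' * m] steps [x] gains
   [N * c * (m' - m) * p * L >= N]. *)
pose N := (Num.truncn `|y 1%N + k%:R * L - x 1%N|).+1.
have NE : y 1%N + k%:R * L - x 1%N < N%:R.
  by rewrite (le_lt_trans (ler_norm _))// truncnS_gt.
pose c := ((Num.truncn (L^-1)).+1)%N.
have cL : 1 < c%:R * L by rewrite -ltr_pdivrMr// div1r truncnS_gt.
have := step (N * c * m' * m)%N.
rewrite -add1n (periodic_polygonM p m x 1 _ px) (mulnAC (N * c)%N m' m) (periodic_polygonM p m' y 1 _ py).
rewrite !natrM => hN.
have pL : 1 <= p%:R :> R by rewrite ler1n.
have mm : m%:R + 1 <= m'%:R :> R by rewrite natr1 ler_nat.
have N0 : 0 < N%:R :> R by rewrite ltr0n.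
have d1 : N%:R <= N%:R * (c%:R * L) * p%:R.
  by rewrite -mulrA ler_peMr ?ltW//; nra.
have d2 : N%:R * (c%:R * L) * p%:R <= N%:R * (c%:R * L) * p%:R * (m'%:R - m%:R).
  by rewrite ler_peMr//; nra.
have : N%:R * (c%:R * L) * p%:R * (m'%:R - m%:R) =
    N%:R * c%:R * m'%:R * (p%:R * L) - N%:R * c%:R * m%:R * (p%:R * L) by ring.
lra.
Qed.

(* [x_0, x_1], then once around [y] from [y_2] to [y_1 + s], then the rest of
   [x] from [x_2 + s]; here [s] is the translation by [p] turns. *)
Definition splice (m' : nat) (s : R) (x y : nat -> R) (k : nat) :=
  if (k <= 1)%N then x k else if (k <= m'.+1)%N then y k else x (k - m')%N + s.

(** The new steps, from [x_1] to [y_2] and from [y_1 + s] to [x_2 + s], lie in [[0, L]] because the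
    side of [y] is nested in that of [x]. *)
Lemma splice_inscribed p m m' x y : (0 < m')%N -> (1 < m)%N ->
  periodic_polygon p m x -> periodic_polygon p m' y ->
  x 1%N <= y 1%N -> y 2%N <= x 2%N ->
  inscribed_polygon L (p + p) (m + m') (splice m' (p%:R * L) x y).
Proof.
move=> m'0 m1 [xs xm] [ys ym] xy1 yx2; rewrite /splice.
have x1 := xs 1%N; have y1 := ys 1%N.
have ym1 : y m'.+1 = y 1%N + p%:R * L by rewrite -ym add1n.
split.
- move=> [|[|k]] km /=; first exact: xs.
    by rewrite ltnS m'0; lra.
  case: ltngtP => km'.
  + exact: ys.
  + rewrite subSn; last by rewrite ltnW// ltnW.
    by have := xs (k.+2 - m')%N; lra.
  + rewrite km' ym1 subSn ?leqnSn// subSnn; lra.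
- have -> : (m + m' <= 1)%N = false.
    by apply/negbTE; rewrite -ltnNge (leq_trans m1)// leq_addr.
  have -> : (m + m' <= m'.+1)%N = false.
    by apply/negbTE; rewrite -ltnNge -[m'.+1]add1n ltn_add2r.
  by rewrite addnK /= -[m]add0n xm natrD mulrDl addrA.
Qed.

(** Only the nested sides are traded; every other side reappears, possibly translated by full turns,
    to which [h] is insensitive. *)
Lemma splice_length p m m' x y : (0 < m')%N -> (1 < m)%N ->
  periodic_polygon p m x -> periodic_polygon p m' y ->
  polygon_length (m + m') (splice m' (p%:R * L) x y) + h (x 1%N) (x 2%N) + h (y 1%N) (y 2%N) =
  polygon_length m x + polygon_length m' y + h (x 1%N) (y 2%N) + h (y 1%N) (x 2%N).
Proof.
case: m' => // m' _; case: m => [|[|m]]// _ px py.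
rewrite -(polygon_length_shift _ _ _ 1 py).
have ym1 : y m'.+2 = y 1%N + p%:R * L by rewrite -py.2 add1n.
set z := splice _ _ x y.
have zy k : (k < m'.+1)%N -> z k.+2 = y k.+2 by move=> km; rewrite /z /splice /= ltnS km.
have zx k : z (m' + k).+3 = x k.+2 + p%:R * L.
  rewrite /z /splice /= ifF; last by apply/negbTE; rewrite -ltnNge !ltnS leq_addr.
  by congr (x _ + _); rewrite subSS -!addnS addKn.
have z01 : z 0%N = x 0%N /\ z 1%N = x 1%N by [].
clearbody z; rewrite /polygon_length.
have -> : (m.+2 + m'.+1 = (m' + m.+1).+2)%N by rewrite !addSn !addnS addnC.
rewrite (sum_ord_head (fun k => h (z k) (z k.+1)))//.
rewrite (sum_ord_head (fun k => h (z k.+1) (z k.+2)))// big_split_ord /=.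
rewrite (sum_ord_head (fun k => h (z (m' + k).+2) (z (m' + k).+3)))//= addn0.
rewrite (sum_ord_head (fun k => h (x k) (x k.+1)))//.
rewrite (sum_ord_head (fun k => h (x k.+1) (x k.+2)))//.
rewrite (sum_ord_head (fun k => h (y (k + 1)%N) (y (k.+1 + 1)%N)))//=.
have -> : \sum_(k < m') h (z k.+2) (z k.+3) = \sum_(k < m') h (y (k.+1 + 1)%N) (y (k.+2 + 1)%N).
  apply: eq_bigr => k _; have km := ltn_ord k.
  by rewrite !zy ?addn1// ltnW.
have -> : \sum_(k < m) h (z (m' + k.+1).+2) (z (m' + k.+1).+3) = \sum_(k < m) h (x k.+2) (x k.+3).
  by apply: eq_bigr => k _; rewrite addnS !zx -addnS zx h_periodicl h_periodicr.
have -> : z m'.+3 = x 2%N + p%:R * L by rewrite -[in LHS](addn0 m') zx.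
rewrite (zy m') ?ltnSn// ym1 h_periodicl h_periodicr (zy 0%N)// z01.1 z01.2.
by lra.
Qed.

(** Abstract law of reflection: as for billiards, two consecutive vertices determine the next
    one. *)
Hypothesis h_successor : forall a v b b', a < v < a + L -> v < b < v + L -> v < b' < v + L ->
  (forall w, a <= w <= a + L -> b - L <= w <= b -> h a w + h w b <= h a v + h v b) ->
  (forall w, a <= w <= a + L -> b' - L <= w <= b' -> h a w + h w b' <= h a v + h v b') ->
  b = b'.

(* Nested sides are traded for crossing ones. If they share the vertex [x_1],
   nothing is gained, but then [x] and the spliced polygon are both longest and
   [h_successor] yields a contradiction. *)
Lemma longest_polygon_exchange p q m m' x y (M : R) : (0 < p)%N -> (p < m)%N -> (m < m')%N ->
  (m + m' = q + q)%N -> longest_polygon p m x -> longest_polygon p m' y ->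
  (forall z, inscribed_polygon L p q z -> polygon_length q z <= M) ->
  polygon_length m x + polygon_length m' y < M + M.
Proof.
move=> p0 pm mm' mq xmax ymax hM.
have m1 : (1 < m)%N by exact: leq_ltn_trans pm.
have m'0 : (0 < m')%N by exact: leq_ltn_trans mm'.
have q0 : (0 < q)%N by case: q mq {hM} => // /eqP; rewrite addn_eq0 => /andP[/eqP m0]; rewrite m0 in m1.
have hMM z : inscribed_polygon L (p + p) (m + m') z -> polygon_length (m + m') z <= M + M.
  rewrite mq => /(polygon_halving _ _ _ q0)[a [b [ia ib /le_trans]]]; apply.
  by rewrite lerD// hM.
have [i [k [xy1 yx2]]] := nested_steps p m m' x y p0 (ltnW m1) mm' xmax.1 ymax.1.
rewrite -(polygon_length_shift _ _ _ i xmax.1) -(polygon_length_shift _ _ _ i ymax.1).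
rewrite -(polygon_length_translate _ (fun l => y (l + i)%N) k).
have {}xmax := longest_polygon_shift _ _ _ i xmax.
have {}ymax := longest_polygon_translate _ _ _ k (longest_polygon_shift _ _ _ i ymax).
move: xy1 yx2; rewrite -![i.+1]add1n -![i.+2]add2n.
move: xmax ymax; set X := fun l => x (l + i)%N.
set Y := fun l => y (l + i)%N + k%:R * L.
rewrite -/(X 1%N) -/(X 2%N) -/(Y 1%N) -/(Y 2%N); move: X Y => {x y i k} x y.
move=> xmax ymax xy1 yx2.
have iz := splice_inscribed p m m' x y m'0 m1 xmax.1 ymax.1 xy1 (ltW yx2).
have zlen := splice_length p m m' x y m'0 m1 xmax.1 ymax.1.
have zM := hMM _ iz.
have y12 : y 1%N <= y 2%N by have := ymax.1.1 1%N; lra.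
have x2L : x 2%N <= x 1%N + L by have := xmax.1.1 1%N; lra.
move: xy1; rewrite le_eqVlt => /predU1P[xy1|xy1]; last first.
  by have := h_quadrangle _ _ _ _ xy1 y12 yx2 x2L; lra.
rewrite ltNge; apply/negP => hge.
have mm'0 : (0 < m + m')%N by rewrite addn_gt0 m'0 orbT.
have [z [pz zE]] := inscribed_polygon_unroll _ _ _ mm'0 iz.
(* With [x_1 = y_1] the trade preserves the total length, so under [hge] the spliced polygon reaches
   the upper bound [M + M]. It shares the vertices 0 and 1 with [x], but continues with
   [y_2 < x_2]. *)
have zmax : longest_polygon (p + p) (m + m') z.
  split => // z' /hMM; rewrite (eq_polygon_length _ _ _ zE) => hz'.
  by apply: le_trans hz' _; rewrite xy1 in zlen; lra.
have mm'1 : (1 < m + m')%N by rewrite (leq_trans m1)// leq_addr.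
have mm'2 : (p + p < m + m')%N by rewrite -addnS leq_add//; [exact: ltnW|exact: ltn_trans mm'].
have pp0 : (0 < p + p)%N by rewrite addn_gt0 p0.
have z0 : z 0%N = x 0%N by rewrite zE.
have z1 : z 1%N = x 1%N by rewrite zE// ltnW.
have z2 : z 2%N = y 2%N by rewrite zE// /splice /= ltnS m'0.
have zl1 := longest_polygon_step_neq0 _ _ z 1 pp0 mm'1 zmax.
have zu1 := longest_polygon_step_ltL _ _ z 1 pp0 mm'2 zmax.
have xl0 := longest_polygon_step_neq0 _ _ x 0 p0 m1 xmax.
have xu0 := longest_polygon_step_ltL _ _ x 0 p0 pm xmax.
have xl1 := longest_polygon_step_neq0 _ _ x 1 p0 m1 xmax.
have xu1 := longest_polygon_step_ltL _ _ x 1 p0 pm xmax.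
have zV w := longest_polygon_vertex _ _ z 0 w mm'1 zmax.
have xV w := longest_polygon_vertex _ _ x 0 w m1 xmax.
rewrite z0 z1 z2 in zl1 zu1 zV.
have := h_successor (x 0%N) (x 1%N) (x 2%N) (y 2%N).
rewrite xl0 xu0 xl1 xu1 zl1 zu1 => /(_ isT isT isT xV zV) xy2.
by rewrite xy2 ltxx in yx2.
Qed.

End PolygonExchange.

(** * The twist condition and longest polygons *)

Section TwistChords.
Context {R : realType} {n : nat}.
Variables (g g1 : R -> 'rV[R]_n) (L : R).
Hypothesis g_der : forall t : R, is_derive t 1 g (g1 t).
Hypothesis tw_lt0 : forall x y, x < y < x + L -> twist g g1 x y < 0.

Local Notation chord := (chord_length g).

Lemma twist_simple x y : x < y < x + L -> g x <> g y.
Proof.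
move=> /tw_lt0 + gxy; rewrite /twist gxy subrr !(dotC _ 0) !dot0l !(mul0r, mulr0) subrr.
by rewrite ltxx.
Qed.

(** Even if [b = c] or [d = a + L], the points with [a < x < b] and [c <= y <= d] stay in the open
    strip where the twist is negative. *)
Lemma chord_quadrangle a b c d : a < b -> b <= c -> c < d -> d <= a + L ->
  chord a d + chord b c < chord a c + chord b d.
Proof.
move=> ab bc cd da.
have inU x y : a < x < b -> c <= y <= d -> x < y < x + L by lra.
have [|x [y [xab ycd E]]] := mixed_difference g g1 g_der a b c d ab cd.
  by move=> x y xab ycd; apply: twist_simple; exact: inU.
have xyU : x < y < x + L by apply: inU; lra.
have c0 := chord_length_gt0 g _ _ (twist_simple _ _ xyU).
have : 0 < - (twist g g1 x y / chord x y ^+ 3 * (d - c) * (b - a)).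
  rewrite -!mulNr !mulr_gt0 ?subr_gt0// ?oppr_gt0 ?tw_lt0//.
  by rewrite invr_gt0 exprn_gt0.
by rewrite -E; lra.
Qed.

(** Negative twist makes the direction of departure at [v] determine the next vertex. *)
Lemma chord_cos_decreasing v y y' : v < y -> y < y' -> y' < v + L ->
  chord_cos g g1 v y' < chord_cos g g1 v y.
Proof.
move=> vy yy' yL.
have vU z : z \in `[y, y'] -> v < z < v + L by rewrite in_itv/=; lra.
have d z : z \in `[y, y'] ->
    is_derive z 1 (chord_cos g g1 v) (twist g g1 v z / chord v z ^+ 3).
  by move=> zI; apply: is_derive_chord_cos => //; apply: twist_simple; exact: vU.
have dC : {within `[y, y'], continuous (chord_cos g g1 v)}.
  by apply: derivable_within_continuous => z zI; case: (d z zI).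
have [z zI E] := MVT yy' (fun z zI => d z (subset_itv_oo_cc zI)) dC.
have zU : v < z < v + L by apply: vU; exact: subset_itv_oo_cc.
rewrite -subr_lt0 E pmulr_llt0 ?subr_gt0// pmulr_llt0 ?tw_lt0//.
by rewrite invr_gt0 exprn_gt0// chord_length_gt0//; exact: twist_simple.
Qed.

(* The law of reflection at [v]. *)
Lemma optimal_vertex_stationary a v b : a < v < a + L -> v < b < v + L ->
  (forall w, a <= w <= a + L -> b - L <= w <= b ->
    chord a w + chord w b <= chord a v + chord v b) ->
  chord_cos g g1 v b = dot (g1 v) (g v - g a) / chord a v.
Proof.
move=> av vb opt.
(* [lo] and [hi] delimit the admissible positions of the moved vertex; [v] is interior, so the
   derivative vanishes there. *)
pose lo := Num.max a (b - L); pose hi := Num.min (a + L) b.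
have loE : lo < v by rewrite gt_max; lra.
have hiE : v < hi by rewrite lt_min; lra.
have inI w : w \in `]lo, hi[ -> (a < w < a + L) * (w < b < w + L).
  by rewrite in_itv/= gt_max lt_min => /andP[/andP[? ?] /andP[? ?]]; split; lra.
pose f := (chord a + chord^~ b : R -> R).
have df w : w \in `]lo, hi[ ->
    is_derive w 1 f (dot (g1 w) (g w - g a) / chord a w + - chord_cos g g1 w b).
  move=> /inI[aw wb]; apply: is_deriveD.
  - by apply: is_derive_chord_right => //; exact: twist_simple.
  - by apply: is_derive_chord_left => //; exact: twist_simple.
have vI : v \in `]lo, hi[ by rewrite in_itv/= loE hiE.
have lohi : lo <= hi by apply: ltW; exact: lt_trans hiE.
have [||_ d0] := @derive1_at_max R f lo hi v lohi _ vI.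
- by move=> w /df[].
- by move=> w /inI[aw wb]; apply: opt; lra.
have [_ d1] := df v vI; move: d1; rewrite d0 => /esym/eqP.
by rewrite subr_eq0 => /eqP.
Qed.

(** By the law of reflection [a] and [v] fix the value of [chord_cos] at the successor, and
    [chord_cos] is strictly decreasing. *)
Lemma optimal_successor_unique a v b b' : a < v < a + L -> v < b < v + L -> v < b' < v + L ->
  (forall w, a <= w <= a + L -> b - L <= w <= b ->
    chord a w + chord w b <= chord a v + chord v b) ->
  (forall w, a <= w <= a + L -> b' - L <= w <= b' ->
    chord a w + chord w b' <= chord a v + chord v b') ->
  b = b'.
Proof.
move=> av vb vb' opt opt'.
have := optimal_vertex_stationary a v b av vb opt.
rewrite -(optimal_vertex_stationary a v b' av vb' opt') => E.
have [bb'|bb'|//] := ltgtP b b'.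
- have := chord_cos_decreasing v b b'; rewrite E ltxx => H.
  by have : false by apply: H => //; lra.
- have := chord_cos_decreasing v b' b; rewrite E ltxx => H.
  by have : false by apply: H => //; lra.
Qed.

End TwistChords.

Lemma continuous_sum_ord {R : realType} {T : topologicalType} q (f : 'I_q -> T -> R) :
  (forall i, continuous (f i)) -> continuous (fun v => \sum_(i < q) f i v).
Proof.
move=> cf v; apply: cvg_big => [|i _]; first exact: add_continuous.
exact: cf.
Qed.

(** * Existence of longest polygons by compactness *)

Section LongestPolygons.
Context {R : realType} {n : nat}.
Variables (g : R -> 'rV[R]_n) (L : R).
Hypothesis g_continuous : continuous g.
Hypothesis L_gt0 : 0 < L.
Hypothesis g_periodic : periodic g L.

Lemma chord_length_periodic x y : chord_length g x (y + L) = chord_length g x y.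
Proof. by rewrite /chord_length g_periodic. Qed.

Lemma enorm_continuous : continuous (@enorm R n).
Proof.
move=> u.
have du : {for u, continuous (fun u : 'rV[R]_n => dot u u)}.
  exact: (@cvg_dot R n _ (nbhs u) _ id id u u (fun A nA => nA) (fun A nA => nA)).
apply: (continuous_comp du); exact: sqrt_continuous.
Qed.

Lemma exists_longest_polygon p q : (p <= q)%N -> exists x,
  inscribed_polygon L p q x /\
  forall x', inscribed_polygon L p q x' -> perimeter g q x' <= perimeter g q x.
Proof.
move=> pq.
pose X (v : 'rV[R]_q.+1) (i : nat) : R := v 0 (inord i).
have cX i : continuous (X^~ i) by move=> v; exact: coord_continuous.
have cD i j : continuous (fun v => X v i - X v j).
  by move=> v; exact: (cvgB (cX i v) (cX j v)).
pose A := [set v : 'rV[R]_q.+1 | inscribed_polygon L p q (X v) /\ 0 <= X v 0%N <= L].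
have cA : compact A.
  (* The first vertex is at most [L] and each of the [q] steps adds at most [L]. *)
  pose box := [set v : 'rV[R]_q.+1 | forall i, `[0, q.+1%:R * L]%classic (v ord0 i)].
  have cbox : compact box by exact: (@rV_compact _ _ (fun=> `[0, q.+1%:R * L]%classic) (fun=> @segment_compact _ _ _)).
  have -> : A = box `&` (\bigcap_(i in [set i | (i < q)%N])
      ((fun v => X v i.+1 - X v i) @^-1` `[0, L])
      `&` ((fun v => X v q - X v 0%N) @^-1` [set p%:R * L] `&` (X^~ 0%N) @^-1` `[0, L])).
    apply/seteqP; split=> v /=.
    + move=> [[vs vq] v0]; split; last first.
        split; first by move=> i /= iq; rewrite in_itv/=; exact: vs.
        by rewrite in_itv/= vq addrAC subrr add0r.
      have bnd i : (i <= q)%N -> 0 <= X v i <= i.+1%:R * L.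
        elim: i => [|i IH] iq; first by rewrite mul1r.
        have := vs i iq; have := IH (ltnW iq).
        rewrite -[i.+2]addn1 natrD mulrDl mul1r; lra.
      move=> i; rewrite /= in_itv/=.
      have iq : (i <= q)%N by rewrite -ltnS.
      have := bnd i iq; rewrite /X inord_val => /andP[-> /le_trans]; apply.
      by rewrite ler_pM2r// ler_nat.
    + move=> [_ [vs [vq]]]; rewrite in_itv/= => v0; split => //; split.
      * by move=> i iq; have := vs i iq; rewrite /= in_itv.
      * by rewrite -vq addrC subrK.
  apply: compact_closedI => //; apply: closedI.
    apply: closed_bigI => i _; apply: preimage_closed; last exact: interval_closed.
    by move=> v _; exact: cD.
  apply: closedI; apply: preimage_closed.
  - by move=> v _; exact: cD.
  - exact: closed_eq.
  - by move=> v _; exact: cX.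
  - exact: interval_closed.
have rowX x : inscribed_polygon L p q x -> 0 <= x 0%N <= L ->
    exists2 v, A v & perimeter g q (X v) = perimeter g q x.
  move=> [xs xq] x0; pose v := \row_(i < q.+1) x i.
  have vE i : (i <= q)%N -> X v i = x i by move=> iq; rewrite /X /v mxE inordK.
  clearbody v; exists v; last first.
    by apply: eq_bigr => i _; rewrite (vE i (ltnW (ltn_ord i))) (vE _ (ltn_ord i)).
  rewrite /A /= /inscribed_polygon (vE q (leqnn q)) (vE 0%N (leq0n q)); split => //; split => //.
  by move=> i iq; rewrite (vE _ iq) (vE _ (ltnW iq)); exact: xs.
have A0 : A !=set0.
  (* This polygon makes [p] full turns and then rests, which is possible as [p <= q]. *)
  have [||v Av _] := rowX (fun i => (minn i p)%:R * L).
  - split => [i iq|]; last by rewrite min0n mul0r add0r (minn_idPr pq).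
    rewrite -mulrBl; case: (boolP (i < p)%N) => ip.
    + rewrite (minn_idPl ip) (minn_idPl (ltnW ip)) -addn1 natrD addrAC subrr add0r mul1r.
      by rewrite lexx ltW.
    + have pi : (p <= i)%N by rewrite leqNgt.
      by rewrite (minn_idPr pi) (minn_idPr (leqW pi)) subrr mul0r lexx ltW.
  - by rewrite min0n mul0r lexx ltW.
  by exists v.
have cF : {within A, continuous (fun v => perimeter g q (X v))}.
  apply: continuous_subspaceT; apply: continuous_sum_ord => i v.
  have cgX j : {for v, continuous (fun v => g (X v j))}.
    exact: (continuous_comp (cX j v) (g_continuous _)).
  exact: (continuous_comp (cvgB (cgX i.+1) (cgX i)) (enorm_continuous _)).
have [v vA vmax] := EVT_max_rV A0 cA cF.
have [iv _] := set_mem vA.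
exists (X v); split => // x [xs xq].
(* Translating by [k] full turns brings the first vertex of an arbitrary polygon into [[0, L]]
   without changing the perimeter. *)
pose k := Num.floor (x 0%N / L).
have gk (t : R) : g (t - k%:~R * L) = g t.
  have gm (m : nat) u : g (u + m%:R * L) = g u.
    elim: m => [|m IH]; first by rewrite mul0r addr0.
    by rewrite -natr1 mulrDl mul1r addrA g_periodic.
  case: k => m; first by rewrite -[in RHS](subrK (m%:R * L) t) gm.
  by rewrite NegzE mulrNz mulNr opprK gm.
have [||w wA wE] := rowX (fun i => x i - k%:~R * L).
- split => [i iq|]; last by rewrite xq addrAC.
  by rewrite opprB addrA subrK; exact: xs.
- have := Num.Theory.floor_itv (x 0%N / L); rewrite -/k.
  rewrite ler_pdivlMr// ltr_pdivrMr// intrD mulrDl mul1r; lra.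
have := vmax w (mem_set wA); rewrite wE.
by congr (_ <= _); apply: eq_bigr => i _; rewrite !gk.
Qed.

Lemma greatest_perimeterE p q x : inscribed_polygon L p q x ->
  (forall x', inscribed_polygon L p q x' -> perimeter g q x' <= perimeter g q x) ->
  greatest_perimeter g L p q = perimeter g q x.
Proof.
move=> ix mx; apply/eqP; rewrite eq_le; apply/andP; split.
- by apply: ge_sup => [|_ [x' ix' <-]]; [exists (perimeter g q x), x|exact: mx].
- apply: ub_le_sup; last by exists x.
  by exists (perimeter g q x) => _ [x' ix' <-]; exact: mx.
Qed.

Lemma longest_polygon_greatest p q : (0 < q)%N -> (p <= q)%N -> exists x,
  longest_polygon (chord_length g) L p q x /\
  greatest_perimeter g L p q = polygon_length (chord_length g) q x.
Proof.
move=> q0 pq; have [x [ix mx]] := exists_longest_polygon p q pq.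
have [x' [px' x'E]] := inscribed_polygon_unroll L p q x q0 ix.
have E : polygon_length (chord_length g) q x' = perimeter g q x by exact: eq_polygon_length.
exists x'; split; last by rewrite E; exact: greatest_perimeterE.
by split => // z iz; rewrite E; exact: mx.
Qed.

End LongestPolygons.

(** * From the hypotheses on the curve to the exchange inequality *)

Theorem mainTheorem6 (R : realType) (n : nat) (hn : (2 <= n)%N)
  (g : R -> 'rV[R]_n) (L : R)
  (hg : arclength_closed_curve g L)
  (h1 : meets_lines_nicely g)
  (h2 : forall t : R, curvature g t <> 0)
  (h3 : forall x y : R, g x <> g y -> ~ orthogonal_planes g x y)
  (p q : nat) (hp : (0 < p)%N) (hpq : (p < q.-1)%N) (hcop : coprime p q) :
  greatest_perimeter g L p q.-1 + greatest_perimeter g L p q.+1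
    < 2 * greatest_perimeter g L p q.
Proof.
have [gsm gu L0 gper gleast] := hg.
pose g1 := derive1 g; pose g2 := derive1 g1.
have g_der (t : R) : is_derive t 1 g (g1 t).
  by apply: DeriveDef; [exact: (gsm 0%N)|rewrite /g1 derive1E].
have g1_der (t : R) : is_derive t 1 g1 (g2 t).
  by apply: DeriveDef; [exact: (gsm 1%N)|rewrite /g2 derive1E].
have g2_continuous : continuous g2.
  by move=> t; apply/differentiable_continuous/derivable1_diffP; exact: (gsm 2%N).
have g1_unit t : dot (g1 t) (g1 t) = 1 by rewrite -enorm_sqr gu expr1n.
(* The inner product of the two perpendicular components, multiplied by [dot c c], is the twist. *)
have twist_neq0 x y : g x <> g y -> twist g g1 x y <> 0.
  move=> gxy tw0; apply: (h3 _ _ gxy); rewrite /orthogonal_planes /perp_component -/g1 /=.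
  have c0 : dot (g y - g x) (g y - g x) != 0.
    by rewrite gt_eqF// dot_gt0// subr_eq0 eq_sym; apply/eqP.
  move: tw0 c0; rewrite /twist; set c := g y - g x; clearbody c => tw0 c0.
  rewrite !(dotBl, dotBr, dotZl, dotZr) (dotC c).
  apply: (mulIf c0); rewrite mul0r -[RHS]tw0; field.
  exact: c0.
have tw := twist_lt0 g g1 g2 g_der g1_der g2_continuous g1_unit twist_neq0 L gleast.
have gc := curve_continuous g g1 g_der.
have q2 : (2 < q)%N by case: q hpq {hcop} => [|[|[|q]]]//; case: p hp => [|[]].
have [||x [xmax ->]] := longest_polygon_greatest g L gc L0 gper p q.-1.
- by case: q q2 {hpq hcop} => [|[]].
- exact: ltnW.
have [||y [ymax ->]] := longest_polygon_greatest g L gc L0 gper p q.+1.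
- by [].
- by rewrite ltnW// (leq_trans hpq)// (leq_trans (leq_pred q)).
have [||z [zmax ->]] := longest_polygon_greatest g L gc L0 gper p q.
- exact: ltnW (ltnW q2).
- by rewrite ltnW// (leq_trans hpq)// leq_pred.
rewrite mulr_natl mulr2n.
have q1q : (q.-1 < q.+1)%N by rewrite ltnS leq_pred.
apply: (longest_polygon_exchange (chord_length g) L L0 (chord_lengthC g) (chord_lengthxx g)
  (chord_length_periodic g L gper) (chord_quadrangle g g1 L g_der tw)
  (optimal_successor_unique g g1 L g_der tw) p q q.-1 q.+1 x y _ hp hpq q1q _ xmax ymax zmax.2).
by case: q q2 {hpq hcop x y z xmax ymax zmax q1q} => // q _; rewrite addnS addSn.
Qed.
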